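(* Let $M\cong\mathbb{Z}^d$ be a lattice with $d\ge 1$. For a matrix $A\in\mathrm{Mat}_d(\mathbb{Z})$ with nonzero determinant and a lattice basis $m_1,\dots,m_d$ of $M$, let $P_A$ be the convex hull of the $2d$ points $\pm a_1,\dots,\pm a_d\in M\otimes\mathbb{R}$, where $a_j=\sum_i A_{i,j}m_i$ is the point whose coefficient vector in this basis is the $j$-th column of $A$. (1) The assignment $A\mapsto P_A$ induces a one-to-one correspondence between equivalence classes of Wirth matrices (in $\mathrm{Mat}_d(\mathbb{N})$) and isomorphism classes of $d$-dimensional reflexive cs-crosspolytopes. For the inverse map: given any facet of a reflexive cs-crosspolytope $P$, there is a lattice basis of $M$ in which the coordinate vectors of the vertices of this facet are the columns of a Wirth matrix corresponding to $P$. (2) Under this correspondence, equivalence classes of 1-minimal Wirth matrices correspond to isomorphism classes of 1-irreducible reflexive cs-crosspolytopes. Moreover, any reflexive cs-crosspolytope $P$ splits, uniquely up to isomorphism, into a 1-irreducible reflexive cs-crosspolytope $P'$ and $r$ copies of $[-1,1]$; here a 1-minimal Wirth matrix associated to $P'$ is the reduction of a Wirth matrix $A$ associated to $P$, and $r$ equals the number of rows of $A$ containing only one entry equal to $1$.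
   Context: $M\cong\mathbb{Z}^d$ and $N=\mathrm{Hom}_{\mathbb{Z}}(M,\mathbb{Z})$ are dual lattices with pairing $\langle\cdot,\cdot\rangle$; $M_{\mathbb{R}}=M\otimes\mathbb{R}$, $N_{\mathbb{R}}=N\otimes\mathbb{R}$. A Fano polytope is a $d$-dimensional lattice polytope $P\subseteq M_{\mathbb{R}}$ with $0$ in its interior and primitive vertices. Its dual is $P^*=\{x\in N_{\mathbb{R}}:\langle x,y\rangle\ge -1\ \forall y\in P\}$; $P$ is reflexive if $P^*$ is a lattice polytope. Two lattice polytopes are isomorphic if some lattice automorphism maps the vertex set of one onto that of the other. A cs-crosspolytope is the convex hull of a simplex not containing $0$ together with its negative (equivalently a $d$-dimensional simplicial polytope with $2d$ vertices having a facet $F$ with $-F$ also a facet). A Wirth matrix is a matrix $A=\begin{pmatrix}2\,\mathrm{id}_f&0\\ C&\mathrm{id}_{d-f}\end{pmatrix}\in\mathrm{Mat}_d(\mathbb{N})$ with $f\in\{0,\dots,d-1\}$ and $C\in\mathrm{Mat}_{(d-f)\times f}(\{0,1\})$ such that every column of $C$ has an odd number of $1$'s. It is 1-minimal if every row of $C$ contains a $1$. The reduction of a Wirth matrix is the 1-minimal Wirth matrix obtained by deleting each row containing only one $1$ (i.e. a row among the last $d-f$ whose part in $C$ is zero) together with the column containing that row's diagonal $1$. Two matrices in $\mathrm{Mat}_d(\mathbb{N})$ are equivalent if they differ by a permutation of columns and left multiplication by a matrix in $\mathrm{GL}_d(\mathbb{Z})$. For Fano polytopes $P_1\subseteq (M_1)_{\mathbb{R}}$,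 $P_2\subseteq (M_2)_{\mathbb{R}}$ with $\dim P_1+\dim P_2=d$, $P$ splits into factors $P_1$ and $P_2$ if $P\cong\mathrm{conv}(P_1\oplus\{0\},\{0\}\oplus P_2)$ under some isomorphism $M\cong M_1\oplus M_2$ (iterating gives splitting into several factors). $P$ is 1-irreducible if $P$ does not split into $[-1,1]$ and some $P_2$. *)

(* Defs.v *)
From HB Require Import structures.
From mathcomp Require Import all_boot all_order all_algebra.
From mathcomp Require Import fingroup perm reals.
Set Implicit Arguments. Unset Strict Implicit. Unset Printing Implicit Defensive.
Import Order.TTheory GRing.Theory Num.Theory.
Local Open Scope ring_scope.

(* The lattice M is Z^n (column vectors 'cV[int]_n), M_R = 'cV[R]_n;
   N = Z^n with the standard pairing (dual basis), N_R = 'cV[R]_n. *)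

Section Geometry.
Variable R : realType.

Definition toR {m n} (A : 'M[int]_(m, n)) : 'M[R]_(m, n) :=
  map_mx (fun z : int => z%:~R) A.

Definition pair {n} (x y : 'cV[R]_n) : R := \sum_i x i 0 * y i 0.

Definition conv_set {n} (S : 'cV[R]_n -> Prop) (x : 'cV[R]_n) : Prop :=
  exists k (p : 'I_k -> 'cV[R]_n) (w : 'I_k -> R),
    (forall i, S (p i)) /\ (forall i, 0 <= w i) /\ \sum_i w i = 1 /\
    x = \sum_i w i *: p i.

Definition conv_pts {n} (s : seq 'cV[R]_n) := conv_set (fun y => y \in s).

Definition same {n} (P Q : 'cV[R]_n -> Prop) := forall x, P x <-> Q x.

Definition lattice_polytope {n} (P : 'cV[R]_n -> Prop) :=
  exists s : seq 'cV[int]_n, same P (conv_pts (map toR s)).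

Definition zero_interior {n} (P : 'cV[R]_n -> Prop) :=
  exists e : R, 0 < e /\ forall x : 'cV[R]_n, (forall i, `|x i 0| <= e) -> P x.

Definition vertex {n} (P : 'cV[R]_n -> Prop) (x : 'cV[R]_n) :=
  P x /\ forall y z (t : R), P y -> P z -> 0 < t < 1 ->
    x = t *: y + (1 - t) *: z -> y = z.

Definition primitive {n} (v : 'cV[int]_n) :=
  forall (k : int) (w : 'cV[int]_n), v = k *: w -> k = 1 \/ k = -1.

(* Fano polytope: lattice polytope, 0 in the interior (hence full-dimensional),
   primitive vertices.  (Nonzero vertices: in dimension >= 1 a vertex is never 0;
   the restriction only matters for the 0-dimensional polytope {0}.) *)
Definition Fano {n} (P : 'cV[R]_n -> Prop) :=
  lattice_polytope P /\ zero_interior P /\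
  forall x, vertex P x -> x != 0 -> exists v, x = toR v /\ primitive v.

Definition dual {n} (P : 'cV[R]_n -> Prop) : 'cV[R]_n -> Prop :=
  fun x => forall y, P y -> -1 <= pair x y.

Definition is_reflexive {n} (P : 'cV[R]_n -> Prop) :=
  Fano P /\ lattice_polytope (dual P).

(* P_A : convex hull of +- the columns of A (0 is added to the point list,
   which changes nothing for n >= 1 and gives {0} for n = 0). *)
Definition Pmx {n} (A : 'M[int]_n) : 'cV[R]_n -> Prop :=
  conv_pts (0 :: [seq toR (col j A) | j <- enum 'I_n]
              ++ [seq - toR (col j A) | j <- enum 'I_n]).

(* cs-crosspolytope: convex hull of the simplex with n linearly independent
   (lattice) vertices v_1..v_n (columns of V, det V != 0) and its negative. *)
Definition cs_cross {n} (P : 'cV[R]_n -> Prop) :=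
  exists V : 'M[int]_n, \det V != 0 /\ same P (Pmx V).

Definition iso {n m} (P : 'cV[R]_n -> Prop) (Q : 'cV[R]_m -> Prop) :=
  exists (U : 'M[int]_(m, n)) (V : 'M[int]_(n, m)),
    V *m U = 1%:M /\ U *m V = 1%:M /\
    (forall x, vertex P x -> vertex Q (toR U *m x)) /\
    (forall y, vertex Q y -> exists x, vertex P x /\ y = toR U *m x).

Definition facet {n} (P F : 'cV[R]_n -> Prop) :=
  (exists (u : 'cV[R]_n) (c : R), u != 0 /\
     (forall y, P y -> c <= pair u y) /\
     (forall x, F x <-> (P x /\ pair u x = c))) /\
  (exists p : 'I_n -> 'cV[R]_n, (forall i, F (p i)) /\
     forall c : 'I_n -> R, \sum_i c i = 0 -> \sum_i c i *: p i = 0 ->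
       forall i, c i = 0).

Definition freesum {n1 n2} (P1 : 'cV[R]_n1 -> Prop) (P2 : 'cV[R]_n2 -> Prop)
  : 'cV[R]_(n1 + n2) -> Prop :=
  conv_set (fun x => (exists y, P1 y /\ x = col_mx y 0) \/
                     (exists z, P2 z /\ x = col_mx 0 z)).

Definition splits {n n1 n2} (P : 'cV[R]_n -> Prop)
  (P1 : 'cV[R]_n1 -> Prop) (P2 : 'cV[R]_n2 -> Prop) :=
  Fano P1 /\ Fano P2 /\ iso P (freesum P1 P2).

Definition seg : 'cV[R]_1 -> Prop :=
  conv_pts [:: const_mx 1; const_mx (-1)].

Definition one_irreducible {n} (P : 'cV[R]_n -> Prop) :=
  ~ exists n2 (Q : 'cV[R]_n2 -> Prop), splits P seg Q.

Inductive splits_segs : forall n, ('cV[R]_n -> Prop) ->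
    forall n', ('cV[R]_n' -> Prop) -> nat -> Prop :=
| splits_segs0 n (P : 'cV[R]_n -> Prop) n' (P' : 'cV[R]_n' -> Prop) :
    iso P P' -> splits_segs P P' 0
| splits_segsS n (P : 'cV[R]_n -> Prop) n2 (Q : 'cV[R]_n2 -> Prop)
    n' (P' : 'cV[R]_n' -> Prop) r :
    splits P seg Q -> splits_segs Q P' r -> splits_segs P P' r.+1.

End Geometry.

Section Matrices.
(* Wirth matrices, represented in 'M[int]_n (entries in {0,1,2}). *)

Definition wirth_f {n} (A : 'M[int]_n) (f : nat) :=
  (f < n)%N /\
  (forall i j : 'I_n, (i < f)%N -> A i j = (if i == j then 2 else 0)) /\
  (forall i j : 'I_n, (f <= i)%N -> (f <= j)%N -> A i j = (i == j)%:R) /\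
  (forall i j : 'I_n, (f <= i)%N -> (j < f)%N -> A i j = 0 \/ A i j = 1) /\
  (forall j : 'I_n, (j < f)%N ->
     odd #|[set i : 'I_n | (f <= i)%N && (A i j == 1)]|).

Definition wirth {n} (A : 'M[int]_n) := exists f, wirth_f A f.

Definition wirth_1min {n} (A : 'M[int]_n) :=
  exists f, wirth_f A f /\
    forall i : 'I_n, (f <= i)%N -> exists j : 'I_n, (j < f)%N /\ A i j = 1.

Definition mx_equiv {n} (A A' : 'M[int]_n) :=
  exists (U : 'M[int]_n) (s : {perm 'I_n}), U \in unitmx /\ A' = U *m A *m perm_mx s.

Definition single_one {n} (A : 'M[int]_n) (i : 'I_n) :=
  #|[set j | A i j == 1]| == 1%N.

Definition kept {n} (A : 'M[int]_n) : {set 'I_n} := [set i | ~~ single_one A i].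

Definition num_single {n} (A : 'M[int]_n) : nat := #|[set i | single_one A i]|.

(* reduction: delete the rows with a single 1 and the columns of their
   diagonal 1 (i.e. the columns with the same index) *)
Definition reduction {n} (A : 'M[int]_n) : 'M[int]_#|kept A| :=
  \matrix_(i, j) A (enum_val i) (enum_val j).

End Matrices.

Arguments Pmx R {n} A.
Arguments toR R {m n} A.
Arguments seg R.

(* Main.v *)
Require Import Defs.
From mathcomp Require Import all_boot all_order all_algebra.
From mathcomp Require Import perm action primitive_action alt reals.
From mathcomp Require Import zify ring lra.
Set Implicit Arguments. Unset Strict Implicit. Unset Printing Implicit Defensive.
Import Order.TTheory GRing.Theory Num.Theory.
Local Open Scope ring_scope.

(** The vertices of the dual of [P_V] are the vectors [x] with [x^T V] a sign vector, so [P_V]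
    is reflexive iff [2 V^-1] is integral and some integral row [u] satisfies [u V = (1,...,1)];
    primitivity of the columns is then automatic. The rows of such a [V] span a lattice between
    [2 Z^d] and [Z^d], so up to left multiplication by unimodular matrices [V] is determined by
    its row space modulo 2, and the condition on [u] says that this space contains [(1,...,1)].
    Sign changes of the vertices act trivially modulo 2, so isomorphism of reflexive
    cs-crosspolytopes is equality of these row spaces up to a permutation of the coordinates.
    The row space modulo 2 of a Wirth matrix is that of the systematic form [(C 1)], which every
    space has up to a permutation. Splitting off [-1,1] means that the space contains a unit
    vector, i.e. that [C] has a zero row, and unit vectors can be cancelled up to permutation. *)

(** * Matrices *)

Lemma perm_extend_inj (T I : finType) (g h : I -> T) : injective g -> injective h ->
  exists s : {perm T}, forall i, s (g i) = h i.
Proof.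
move=> injg injh; have leIT := leq_card _ injg.
have dtuple_val (k : I -> T) : injective k ->
    [tuple k (enum_val i) | i < #|I|] \in #|I|.-dtuple([set: T]).
  move=> injk; apply/dtuple_onP; split=> [i j|i]; last by rewrite inE.
  by rewrite !tnth_mktuple => /injk /enum_val_inj.
have [s _ /(congr1 (fun t => tnth t _)) gh] :=
  atransP2 (ntransitive_weak leIT (Sym_trans T)) (dtuple_val g injg) (dtuple_val h injh).
exists s => i; have := gh (enum_rank i).
by rewrite tnth_mktuple [RHS]tnth_map tnth_mktuple !enum_rankK.
Qed.

Lemma perm_fix0_lift n (s : {perm 'I_n.+1}) : s 0 = 0 ->
  exists s' : {perm 'I_n}, s = lift0_perm s'.
Proof.
move=> s0; have sSneq0 j : 0 != s (lift 0 j) by rewrite -{1}s0 (inj_eq perm_inj) neq_lift.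
have /fin_all_exists [g sS] j : exists k, s (lift 0 j) = lift 0 k.
  by have [k ->] := unlift_some (sSneq0 j); exists k.
have injg : injective g.
  by move=> j k gjk; apply/(@lift_inj _ 0)/(@perm_inj _ s); rewrite !sS gjk.
exists (perm injg); apply/permP => k; case: (unliftP 0 k) => [j|] ->.
  by rewrite lift0_perm_lift permE sS.
by rewrite lift0_perm0.
Qed.

Lemma mul_colsub_rowsub (S : pzSemiRingType) m n n' p (phi : 'I_n' -> 'I_n)
    (A : 'M[S]_(m, n)) (B : 'M_(n, p)) : bijective phi ->
  colsub phi A *m rowsub phi B = A *m B.
Proof.
move=> bij_phi; apply/matrixP=> i j; rewrite !mxE [RHS](reindex phi); last exact: onW_bij.
by apply: eq_bigr => k _; rewrite !mxE.
Qed.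

Definition dsum_mx (S : nmodType) m n m' n' (A : 'M[S]_(m, n)) (B : 'M_(m', n')) :=
  block_mx A 0 0 B.

Definition unit_ext (S : pzSemiRingType) r n (A : 'M[S]_n) := dsum_mx (1%:M : 'M_r) A.

Section DirectSums.
Variable S : pzSemiRingType.

Lemma mul_dsum_mx m n p m' n' p' (A : 'M[S]_(m, n)) (A' : 'M_(m', n'))
    (B : 'M_(n, p)) (B' : 'M_(n', p')) :
  dsum_mx A A' *m dsum_mx B B' = dsum_mx (A *m B) (A' *m B').
Proof. by rewrite mulmx_block !mul0mx !mulmx0 !addr0 !add0r. Qed.

Lemma mul_dsum_col m n p m' n' (A : 'M[S]_(m, n)) (A' : 'M_(m', n'))
    (B : 'M_(n, p)) (B' : 'M_(n', p)) :
  dsum_mx A A' *m col_mx B B' = col_mx (A *m B) (A' *m B').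
Proof. by rewrite mul_block_col !mul0mx addr0 add0r. Qed.

Lemma mul_row_dsum m n p n' p' (B : 'M[S]_(m, n)) (B' : 'M_(m, n'))
    (A : 'M_(n, p)) (A' : 'M_(n', p')) :
  row_mx B B' *m dsum_mx A A' = row_mx (B *m A) (B' *m A').
Proof. by rewrite mul_row_block !mulmx0 addr0 add0r. Qed.

Lemma dsum_scalar_mx m n (a : S) : dsum_mx (a%:M : 'M_m) (a%:M : 'M_n) = a%:M.
Proof. exact/esym/scalar_mx_block. Qed.

Lemma unit_ext0 n (A : 'M[S]_n) : unit_ext 0 A = A.
Proof.
apply/matrixP=> i j; case: (split_ordP i) => [[]|k] // ->; case: (split_ordP j) => [[]|l] // ->.
by rewrite block_mxEdr; congr (A _ _); apply: val_inj.
Qed.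

Lemma unit_extS r n (A : 'M[S]_n) : unit_ext r.+1 A = unit_ext 1 (unit_ext r A).
Proof.
apply/esym; rewrite /unit_ext /dsum_mx.
rewrite -[X in block_mx _ X _ _]row_mx0 -[X in block_mx _ _ X _]col_mx0.
rewrite block_mxA castmx_id row_mx0 col_mx0; congr block_mx.
exact: esym (scalar_mx_block 1 r 1).
Qed.
End DirectSums.

Lemma unit_ext_reorder (S : pzSemiRingType) n (A : 'M[S]_n) (U K : {set 'I_n}) :
  U = ~: K -> (forall i j, i \in U -> A i j = (i == j)%:R) ->
  (forall i j, j \in U -> A i j = (i == j)%:R) ->
  exists2 phi : 'I_(#|U| + #|K|) -> 'I_n, bijective phi &
    mxsub phi phi A = unit_ext #|U| (mxsub (@enum_val _ (mem K)) (@enum_val _ (mem K)) A).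
Proof.
move=> UK rowU colU.
pose phi (k : 'I_(#|U| + #|K|)) : 'I_n :=
  match split k with inl a => enum_val a | inr b => enum_val b end.
have phil a : phi (lshift _ a) = enum_val a.
  by rewrite /phi -[lshift _ _]/(unsplit (inl _)) unsplitK.
have phir b : phi (rshift _ b) = enum_val b.
  by rewrite /phi -[rshift _ _]/(unsplit (inr _)) unsplitK.
have neq_UK (a : 'I_#|U|) (b : 'I_#|K|) : (enum_val a == enum_val b) = false.
  by apply/eqP=> ab; have := enum_valP a; rewrite ab UK inE enum_valP.
exists phi.
  apply: inj_card_bij => [i j|]; last first.
    by rewrite !card_ord UK addnC cardsC card_ord.
  case: (split_ordP i) => a ->; case: (split_ordP j) => b ->; rewrite ?phil ?phir => /eqP.
  - by move/eqP/enum_val_inj ->.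
  - by rewrite neq_UK.
  - by rewrite eq_sym neq_UK.
  - by move/eqP/enum_val_inj ->.
apply/matrixP=> i j.
case: (split_ordP i) => a ->; case: (split_ordP j) => b ->; rewrite mxE ?phil ?phir.
- by rewrite block_mxEul mxE rowU ?enum_valP // (inj_eq enum_val_inj).
- by rewrite block_mxEur mxE rowU ?enum_valP // neq_UK.
- by rewrite block_mxEdl mxE colU ?enum_valP // eq_sym neq_UK.
- by rewrite block_mxEdr mxE.
Qed.

Section RowSpaces.
Variable F : fieldType.

Lemma submx_dsum m m' n p p' q (A : 'M[F]_(m, n)) (B : 'M_(p, q))
    (A' : 'M_(m', n)) (B' : 'M_(p', q)) :
  (dsum_mx A B <= dsum_mx A' B')%MS = (A <= A')%MS && (B <= B')%MS.
Proof.
apply/submxP/andP=> [[D]|[/submxP [D ->] /submxP [E ->]]]; last first.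
  by exists (dsum_mx D E); rewrite mul_dsum_mx.
rewrite -[D]submxK mulmx_block !mulmx0 !addr0 !add0r => /eq_block_mx [-> _ _ ->].
by rewrite !submxMl.
Qed.

Lemma eqmx_dsum m m' n p p' q (A : 'M[F]_(m, n)) (B : 'M_(p, q))
    (A' : 'M_(m', n)) (B' : 'M_(p', q)) :
  (dsum_mx A B :=: dsum_mx A' B')%MS <-> (A :=: A')%MS /\ (B :=: B')%MS.
Proof.
split=> [eqAB|[eqA eqB]]; last by apply/eqmxP; rewrite !submx_dsum !eqA !eqB !submx_refl.
have : (dsum_mx A B == dsum_mx A' B')%MS by apply/eqmxP.
rewrite !submx_dsum => /andP[/andP[AA' BB'] /andP[A'A B'B]].
by split; apply/eqmxP/andP.
Qed.

Lemma tperm_stable_rowspace m n (A : 'M[F]_(m, n)) i j :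
  ((delta_mx 0 i : 'rV_n) <= A)%MS -> ((delta_mx 0 j : 'rV_n) <= A)%MS ->
  (A *m perm_mx (tperm i j) :=: A)%MS.
Proof.
move=> iA jA; set t := tperm i j.
have stable_tperm : (A *m perm_mx t <= A)%MS.
  apply/row_subP=> k; rewrite row_mul; set x := row k A.
  have -> : x *m perm_mx t = x + (x 0 j - x 0 i) *: (delta_mx 0 i - delta_mx 0 j).
    apply/rowP=> l; rewrite -[t]invgK -col_permE tpermV !mxE.
    by case: tpermP => [->|->|/eqP li /eqP lj]; rewrite ?eqxx ?(negPf li) ?(negPf lj);
      [have [->|_] := eqVneq i j | have [->|_] := eqVneq j i |]; rewrite /=; ring.
  by rewrite addmx_sub ?row_sub // scalemx_sub // addmx_sub // eqmx_opp.
apply/eqmxP; rewrite stable_tperm.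
by rewrite -{1}[A]mulmx1 -perm_mx1 -[1%g](tperm2 i j) perm_mxM mulmxA submxMr.
Qed.

Lemma systematic_form m f r (G : 'M[F]_(m, f + r)) : \rank G = r ->
  exists (s : {perm 'I_(f + r)}) (C : 'M_(r, f)), (G *m perm_mx s :=: row_mx C 1%:M)%MS.
Proof.
move=> rankG; pose H : 'M_(r, f + r) := castmx (rankG, erefl) (row_base G).
have HG : (H :=: G)%MS := eqmx_trans (eqmx_cast _ _) (eq_row_base G).
have fullH : row_full H^T by rewrite /row_full mxrank_tr HG rankG.
have [s sE] := perm_extend_inj (@rshift_inj f r) (@fullrankfun_inj _ _ _ _ fullH).
pose H' := H *m perm_mx s^-1; have H'E : H' = col_perm s H by rewrite col_permE.
have unitR : rsubmx H' \in unitmx.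
  rewrite -unitmx_tr (_ : _^T = rowsub (fullrankfun fullH) H^T) ?fullrowsub_unit //.
  by apply/matrixP=> i k; rewrite H'E !mxE sE.
exists s^-1%g, (invmx (rsubmx H') *m lsubmx H').
apply: eqmx_trans (eqmxMr _ (eqmx_sym HG)) _; rewrite -/H'.
have {1}-> : H' = rsubmx H' *m row_mx (invmx (rsubmx H') *m lsubmx H') 1%:M.
  by rewrite mul_mx_row mulKVmx // mulmx1 hsubmxK.
by apply: eqmxMfull; rewrite row_full_unit.
Qed.

Lemma delta_sub_systematic f r (C : 'M[F]_(r, f)) (j : 'I_(f + r)) :
  ((delta_mx 0 j : 'rV_(f + r)) <= row_mx C 1%:M)%MS <-> exists2 i, j = rshift f i & row i C = 0.
Proof.
split=> [/submxP [z]|[i -> Ci0]]; last first.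
  by rewrite delta_mx_rshift -row1 -Ci0 -row_row_mx row_sub.
rewrite mul_mx_row mulmx1; case: (split_ordP j) => i ->.
  rewrite delta_mx_lshift => /eq_row_mx [dC z0].
  move: dC; rewrite -z0 mul0mx => /rowP /(_ i) /eqP.
  by rewrite !mxE !eqxx oner_eq0.
by rewrite delta_mx_rshift => /eq_row_mx [zC dz]; exists i => //; rewrite rowE dz -zC.
Qed.

Lemma lin_indep_unitmx n (p : 'I_n -> 'cV[F]_n) :
  (forall c : 'I_n -> F, \sum_i c i *: p i = 0 -> forall i, c i = 0) ->
  \matrix_(k, i) p i k 0 \in unitmx.
Proof.
move=> indep; rewrite -unitmx_tr -row_free_unit; apply: inj_row_free => v vp0.
apply/rowP=> i; rewrite [RHS]mxE; apply: (indep (v 0)); apply/colP=> k.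
move/rowP/(_ k): vp0; rewrite summxE !mxE => vp0; rewrite -[RHS]vp0.
by apply: eq_bigr => j _; rewrite !mxE.
Qed.
End RowSpaces.

(** * Reduction modulo 2 *)

Lemma pchar_F2 : 2 \in [pchar 'F_2].
Proof. exact: pchar_Fp. Qed.

Definition modF2 m n (A : 'M[int]_(m, n)) : 'M['F_2]_(m, n) := map_mx intr A.

Definition lift_F2 m n (C : 'M['F_2]_(m, n)) : 'M[int]_(m, n) :=
  map_mx (fun x => (x != 0)%:R) C.

Lemma lift_F2K m n : cancel (@lift_F2 m n) (@modF2 m n).
Proof.
move=> C; apply/matrixP=> i j; rewrite !mxE.
by case: (C i j) => [[|[|]]] //= ?; apply: val_inj.
Qed.

Lemma modF2K m n (A : 'M[int]_(m, n)) :
  (forall i j, A i j = 0 \/ A i j = 1) -> lift_F2 (modF2 A) = A.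
Proof. by move=> A01; apply/matrixP=> i j; rewrite !mxE; case: (A01 i j) => ->. Qed.

Lemma modF2M m n p (A : 'M[int]_(m, n)) (B : 'M_(n, p)) :
  modF2 (A *m B) = modF2 A *m modF2 B.
Proof. exact: map_mxM. Qed.

Lemma modF2_perm n (s : {perm 'I_n}) : modF2 (perm_mx s) = perm_mx s.
Proof. exact: map_perm_mx. Qed.

Lemma modF2_unit n (B : 'M[int]_n) : B \in unitmx -> modF2 B \in unitmx.
Proof. by move=> uB; rewrite unitmxE /modF2 det_map_mx rmorph_unit -?unitmxE. Qed.

Lemma modF2_scalar2 n : modF2 (2%:M : 'M_n) = 0.
Proof. by rewrite /modF2 map_scalar_mx rmorph_nat (pcharf0 pchar_F2) raddf0. Qed.

Lemma modF2_dsum m n m' n' (A : 'M[int]_(m, n)) (B : 'M_(m', n')) :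
  modF2 (dsum_mx A B) = dsum_mx (modF2 A) (modF2 B).
Proof. by rewrite /modF2 map_block_mx !map_mx0. Qed.

Lemma modF2_eq0 m n (A : 'M[int]_(m, n)) : modF2 A = 0 -> exists B, A = 2 *: B.
Proof.
move=> A0; exists (\matrix_(i, j) (A i j %/ 2)%Z); apply/matrixP=> i j.
rewrite !mxE mulrC divzK // (dvdz_pcharf pchar_F2).
by move/matrixP/(_ i j): A0; rewrite !mxE => ->.
Qed.

Lemma half_inverse_det n (V W : 'M[int]_n) : W *m V = 2%:M -> \det V != 0.
Proof.
move/(congr1 determinant); rewrite det_mulmx det_scalar.
by apply: contra_eq_neq => ->; rewrite mulr0 eq_sym expf_eq0 andbF.
Qed.

Lemma half_inverseC n (V W : 'M[int]_n) : W *m V = 2%:M -> V *m W = 2%:M.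
Proof.
move=> WV; apply: (scalemx_inj (half_inverse_det WV)).
rewrite -mul_mx_scalar -mul_mx_adj mulmxA -(mulmxA V) WV mul_mx_scalar -scalemxAl mul_mx_adj.
by rewrite -!mul_scalar_mx scalar_mxC.
Qed.

(* The lattice spanned by the rows of [V] contains [2 Z^n], hence is determined by its image
   modulo 2. *)
Lemma modF2_submxP m n (Z : 'M[int]_(m, n)) (V W : 'M_n) : W *m V = 2%:M ->
  reflect (exists D, Z = D *m V) (modF2 Z <= modF2 V)%MS.
Proof.
move=> WV; apply: (iffP submxP) => [[D ZD]|[D ->]]; last by exists (modF2 D); rewrite modF2M.
have [|U ZW] := @modF2_eq0 _ _ (Z *m W).
  by rewrite modF2M ZD -mulmxA -modF2M (half_inverseC WV) modF2_scalar2 mulmx0.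
exists U; apply: (@scalemx_inj _ _ _ 2) => //.
by rewrite scalemxAl -ZW -mulmxA WV mul_mx_scalar.
Qed.

Lemma modF2_eqmx_unit_mul n (V V' W W' : 'M[int]_n) :
  W *m V = 2%:M -> W' *m V' = 2%:M -> (modF2 V :=: modF2 V')%MS ->
  exists2 B, B \in unitmx & V' = B *m V.
Proof.
move=> WV WV' eqV; have /(modF2_submxP _ WV) [B V'E] : (modF2 V' <= modF2 V)%MS by rewrite eqV.
have /(modF2_submxP _ WV') [B' VE] : (modF2 V <= modF2 V')%MS by rewrite eqV.
exists B => //; apply: (mulmx1_unit (B := B') _).1; apply: (@scalemx_inj _ _ _ 2) => //.
by rewrite -!mul_mx_scalar -(half_inverseC WV') mulmxA -(mulmxA B) -VE -V'E mul1mx.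
Qed.

(** * Reflexive matrices *)

Definition reflexive_mx n (V : 'M[int]_n) :=
  (exists W, W *m V = 2%:M) /\ (exists u : 'rV_n, u *m V = const_mx 1).

Lemma reflexive_mxP n (V W : 'M[int]_n) : W *m V = 2%:M ->
  ((const_mx 1 : 'rV_n) <= modF2 V)%MS <-> reflexive_mx V.
Proof.
move=> WV; have <- : modF2 (const_mx 1 : 'rV_n) = const_mx 1 by exact: map_const_mx.
split=> [/(modF2_submxP _ WV) [u uV]|[_ [u uV]]]; first by split; [exists W | exists u].
by apply/(modF2_submxP _ WV); exists u.
Qed.

Lemma reflexive_det n (V : 'M[int]_n) : reflexive_mx V -> \det V != 0.
Proof. by case=> [[W /half_inverse_det]]. Qed.

Lemma reflexive_odd_row n (V : 'M[int]_n) (z : 'rV_n) :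
  reflexive_mx V -> modF2 z = const_mx 1 -> exists u, u *m V = z.
Proof.
move=> rV z1; case: (rV) => [[W WV] _].
by have /(reflexive_mxP WV) := rV; rewrite -z1 => /(modF2_submxP _ WV) [u ->]; exists u.
Qed.

Lemma reflexive_mull n (B V : 'M[int]_n) :
  B \in unitmx -> reflexive_mx V -> reflexive_mx (B *m V).
Proof.
move=> uB [[W WV] [u uV]]; split; [exists (W *m invmx B) | exists (u *m invmx B)].
- by rewrite mulmxA mulmxKV.
- by rewrite mulmxA mulmxKV.
Qed.

Lemma reflexive_mulr n (V S : 'M[int]_n) :
  S \in unitmx -> const_mx 1 *m modF2 S = const_mx 1 :> 'rV_n ->
  reflexive_mx V -> reflexive_mx (V *m S).
Proof.
move=> uS S1 rV; case: (rV) => [[W WV] _].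
have WVS : (invmx S *m W) *m (V *m S) = 2%:M.
  by rewrite mulmxA -(mulmxA _ W) WV mul_mx_scalar -scalemxAl mulVmx // scalemx1.
by apply/(reflexive_mxP WVS); rewrite -S1 modF2M submxMr //; apply/(reflexive_mxP WV).
Qed.

Lemma reflexive_perm n (V : 'M[int]_n) (s : {perm 'I_n}) :
  reflexive_mx V -> reflexive_mx (V *m perm_mx s).
Proof.
apply: reflexive_mulr; first exact: unitmx_perm.
by rewrite modF2_perm -[s]invgK -col_permE col_perm_const.
Qed.

Lemma intr_F2_sign (b : bool) : ((-1) ^+ b)%:~R = 1 :> 'F_2.
Proof. by rewrite rmorph_sign; case: b; rewrite // expr1 (oppr_pchar2 pchar_F2). Qed.

Lemma modF2_sign m n (b : bool) (A : 'M[int]_(m, n)) : modF2 ((-1) ^+ b *: A) = modF2 A.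
Proof. by apply/matrixP=> i j; rewrite !mxE rmorphM /= intr_F2_sign mul1r. Qed.

Definition sign_row n (e : 'I_n -> bool) : 'rV[int]_n := \row_j (-1) ^+ e j.

Lemma modF2_sign_row n (e : 'I_n -> bool) : modF2 (sign_row e) = const_mx 1.
Proof. by apply/rowP=> j; rewrite !mxE intr_F2_sign. Qed.

Lemma reflexive_sign n (V : 'M[int]_n) (e : 'I_n -> bool) :
  reflexive_mx V -> reflexive_mx (V *m diag_mx (sign_row e)).
Proof.
apply: reflexive_mulr.
  apply: (mulmx1_unit (B := diag_mx (sign_row e)) _).1.
  rewrite mulmx_diag; apply/matrixP=> i j; rewrite !mxE -expr2 sqrr_sign.
  by case: eqP.
have -> : modF2 (diag_mx (sign_row e)) = diag_mx (modF2 (sign_row e)) by exact: map_diag_mx.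
by rewrite modF2_sign_row diag_const_mx mulmx1.
Qed.

Lemma reflexive_dsum m n (X : 'M[int]_m) (Y : 'M_n) :
  reflexive_mx (dsum_mx X Y) <-> reflexive_mx X /\ reflexive_mx Y.
Proof.
split=> [[[W] + [u]]|[[[W WX] [u uX]] [[W' WY] [u' uY]]]].
  rewrite -[W]submxK -[u]hsubmxK mul_row_dsum mulmx_block !mulmx0 !addr0 !add0r.
  rewrite scalar_mx_block -row_mx_const => /eq_block_mx [WX _ _ WY] /eq_row_mx [uX uY].
  by split; split; eexists; [exact: WX | exact: uX | exact: WY | exact: uY].
split; first by exists (dsum_mx W W'); rewrite mul_dsum_mx WX WY dsum_scalar_mx.
by exists (row_mx u u'); rewrite mul_row_dsum uX uY row_mx_const.
Qed.

Lemma reflexive_mx1 n : reflexive_mx (1%:M : 'M_n).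
Proof. by split; [exists 2%:M | exists (const_mx 1)]; rewrite mulmx1. Qed.

Lemma reflexive_unit_ext r n (Y : 'M[int]_n) : reflexive_mx (unit_ext r Y) <-> reflexive_mx Y.
Proof.
by rewrite reflexive_dsum; split=> [[]|rY] //; split=> //; apply: reflexive_mx1.
Qed.

Lemma mx_equiv_mull n (A B : 'M[int]_n) : B \in unitmx -> mx_equiv A (B *m A).
Proof. by move=> uB; exists B, 1%g; rewrite perm_mx1 mulmx1. Qed.

Lemma mx_equiv_modF2 n (X X' : 'M[int]_n) : reflexive_mx X -> reflexive_mx X' ->
  mx_equiv X X' <-> exists s : {perm 'I_n}, (modF2 X *m perm_mx s :=: modF2 X')%MS.
Proof.
move=> rX rX'; split=> [[U [s [uU ->]]]|[s eqX]].
  exists s; apply: eqmx_sym; rewrite !modF2M modF2_perm -mulmxA.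
  by apply: eqmxMfull; rewrite row_full_unit modF2_unit.
have [[W WX] _] := reflexive_perm s rX; have [[W' WX'] _] := rX'.
have [|B uB ->] := modF2_eqmx_unit_mul WX WX'; first by rewrite modF2M modF2_perm.
by exists B, s; rewrite mulmxA.
Qed.

(* Both row spaces modulo 2 contain the first unit vector, so composing the column permutation
   [s] with the transposition [(0 (s 0))] changes nothing and makes it fix 0. *)
Lemma mx_equiv_unit_ext1_cancel n (X Y : 'M[int]_n) : reflexive_mx X -> reflexive_mx Y ->
  mx_equiv (unit_ext 1 X) (unit_ext 1 Y) -> mx_equiv X Y.
Proof.
move=> rX rY /mx_equiv_modF2 [||s]; try exact/reflexive_unit_ext.
rewrite !modF2_dsum; set X1 := dsum_mx _ _; set Y1 := dsum_mx _ _ => eqXY.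
pose i0 : 'I_(1 + n) := lshift n 0; pose t := tperm i0 (s i0).
have unit_i0 (Z : 'M_n) : ((delta_mx 0 i0 : 'rV_(1 + n)) <= dsum_mx (modF2 1%:M) Z)%MS.
  apply/submxP; exists (delta_mx 0 i0).
  by rewrite delta_mx_lshift mul_row_dsum mul0mx /modF2 map_mx1 mulmx1.
have unit_s_i0 : ((delta_mx 0 (s i0) : 'rV_(1 + n)) <= Y1)%MS.
  have -> : delta_mx 0 (s i0) = delta_mx 0 i0 *m perm_mx s :> 'rV['F_2]_(1 + n).
    by rewrite -rowE; apply/rowP=> j; rewrite !mxE eq_sym.
  by rewrite -eqXY submxMr ?unit_i0.
have eqXYt : (X1 *m perm_mx (s * t)%g :=: Y1)%MS.
  rewrite perm_mxM mulmxA; apply: eqmx_trans (eqmxMr _ eqXY) _.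
  by apply: tperm_stable_rowspace; rewrite ?unit_i0.
have [s' st] : exists s' : {perm 'I_n}, (s * t)%g = lift0_perm s'.
  apply: perm_fix0_lift; rewrite (_ : 0 = i0); last exact: val_inj.
  by rewrite permM tpermR.
apply/mx_equiv_modF2 => //; exists s'.
have : (dsum_mx (modF2 (1%:M : 'M_1) *m 1%:M) (modF2 X *m perm_mx s') :=: Y1)%MS.
  by rewrite -mul_dsum_mx -[dsum_mx 1%:M _]/(lift0_mx _) lift0_mx_perm -st.
by case/eqmx_dsum.
Qed.

(** * Wirth matrices *)

Definition wirth_mx f m (C : 'M['F_2]_(m, f)) : 'M[int]_(f + m) :=
  block_mx 2%:M 0 (lift_F2 C) 1%:M.

Definition odd_columns f m (C : 'M['F_2]_(m, f)) :=
  const_mx 1 *m C = const_mx 1 :> 'rV_f.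

Variant wirth_spec : forall n, 'M[int]_n -> Prop :=
  WirthSpec f m (C : 'M_(m, f)) of (0 < m)%N & odd_columns C : wirth_spec (wirth_mx C).

Lemma natr_F2_eq1 k : (k%:R == 1 :> 'F_2) = odd k.
Proof.
by rewrite -[in LHS](odd_double_half k) natrD -muln2 natrM (pcharf0 pchar_F2) mulr0 addr0;
  case: odd.
Qed.

Lemma odd_columnsP f m (C : 'M['F_2]_(m, f)) :
  odd_columns C <-> forall j, odd #|[set i | C i j != 0]|.
Proof.
have sumC j : (const_mx 1 *m C) (0 : 'I_1) j = #|[set i | C i j != 0]|%:R.
  rewrite -sum1_card natr_sum mxE [RHS]big_mkcond; apply: eq_bigr => i _.
  by rewrite mxE mul1r inE -[in LHS](lift_F2K C) !mxE; case: (C i j != 0).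
split=> [C1 j|oddC]; first by rewrite -natr_F2_eq1 -sumC C1 mxE.
by apply/rowP=> j; rewrite sumC mxE; apply/eqP; rewrite natr_F2_eq1.
Qed.

Lemma odd_columns_gt0 f m (C : 'M['F_2]_(m, f)) : (0 < f)%N -> odd_columns C -> (0 < m)%N.
Proof.
case: m C => // C f0; rewrite /odd_columns (flatmx0 C) mulmx0 => /rowP /(_ (Ordinal f0)) /eqP.
by rewrite !mxE eq_sym oner_eq0.
Qed.

Lemma wirth_mx_column_ones f m (C : 'M['F_2]_(m, f)) (j : 'I_f) :
  #|[set i : 'I_(f + m) | (f <= i)%N && (wirth_mx C i (lshift m j) == 1)]| =
  #|[set i | C i j != 0]|.
Proof.
rewrite -(card_imset _ (@rshift_inj f m)); congr #|pred_of_set _|.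
apply/setP=> i; case: (split_ordP i) => k ->; rewrite !inE.
  rewrite leqNgt /= ltn_ord; apply/esym/imsetP => - [l _ /eqP].
  by rewrite eq_lrshift.
by rewrite block_mxEdl mem_imset ?inE ?mxE ?leq_addr //; [case: (C k j != 0) | apply: rshift_inj].
Qed.

Lemma wirth_fP f m (A : 'M[int]_(f + m)) :
  wirth_f A f <-> exists C, [/\ (0 < m)%N, odd_columns C & A = wirth_mx C].
Proof.
split=> [[lt_fm [upperA [rightA [lowerA oddA]]]]|[C [m0 /odd_columnsP oddC ->]]].
  have AE : A = wirth_mx (modF2 (dlsubmx A)).
    rewrite -[LHS]submxK; congr block_mx.
    - by apply/matrixP=> i j; rewrite !mxE upperA //= (inj_eq (@lshift_inj f m)); case: eqP.
    - by apply/matrixP=> i j; rewrite !mxE upperA //= eq_lrshift.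
    - by rewrite modF2K // => i j; rewrite !mxE; apply: lowerA; rewrite //= leq_addr.
    - by apply/matrixP=> i j; rewrite !mxE rightA /= ?leq_addr // (inj_eq (@rshift_inj f m)).
  exists (modF2 (dlsubmx A)); split=> //; first by rewrite -(ltn_add2l f) addn0.
  by apply/odd_columnsP => j; rewrite -wirth_mx_column_ones -AE; apply: oddA => /=.
split; first by rewrite -{1}[f]addn0 ltn_add2l.
split=> [i j|]; [|split=> [i j|]; [|split=> [i j|j]]]; case: (split_ordP j) => l ->.
- case: (split_ordP i) => k -> // _.
  by rewrite block_mxEul !mxE (inj_eq (@lshift_inj f m)); case: eqP.
- by case: (split_ordP i) => k -> // _; rewrite block_mxEur mxE eq_lrshift.
- by move=> _; rewrite leqNgt /= ltn_ord.
- case: (split_ordP i) => k ->; first by rewrite leqNgt /= ltn_ord.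
  by rewrite block_mxEdr mxE (inj_eq (@rshift_inj f m)).
- case: (split_ordP i) => k ->; first by rewrite leqNgt /= ltn_ord.
  by rewrite block_mxEdl !mxE; case: (C k l != 0); [right | left].
- by [].
- by rewrite wirth_mx_column_ones.
- by [].
Qed.

Lemma wirth_f_addn n (A : 'M[int]_n) f : wirth_f A f -> exists m, n = (f + m)%N.
Proof. by case=> /ltnW fn _; exists (n - f)%N; rewrite subnKC. Qed.

Lemma wirthP n (A : 'M[int]_n) : wirth A <-> wirth_spec A.
Proof.
split=> [[f wA]|]; last by case: n A / => f m C m0 oddC; exists f; apply/wirth_fP; exists C.
have [m nE] := wirth_f_addn wA; subst n.
by have [C [m0 oddC ->]] := (wirth_fP A).1 wA.
Qed.

Lemma modF2_wirth_mx f m (C : 'M['F_2]_(m, f)) : (modF2 (wirth_mx C) :=: row_mx C 1%:M)%MS.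
Proof.
have -> : modF2 (wirth_mx C) = block_mx 0 0 C 1%:M.
  rewrite /modF2 map_block_mx -[map_mx _ 2%:M]/(modF2 _) modF2_scalar2 map_mx0 map_mx1.
  by rewrite -[map_mx _ (lift_F2 C)]/(modF2 _) lift_F2K.
by apply/eqmxP; rewrite /block_mx row_mx0 col_mx_sub sub0mx submx_refl -addsmxE addsmxSr.
Qed.

Lemma reflexive_wirth_mx f m (C : 'M['F_2]_(m, f)) : odd_columns C -> reflexive_mx (wirth_mx C).
Proof.
move=> oddC; have WA : block_mx 1%:M 0 (- lift_F2 C) 2%:M *m wirth_mx C = 2%:M.
  rewrite mulmx_block !mul0mx !mulmx0 !mul1mx mulmx1 !addr0 add0r mul_mx_scalar mul_scalar_mx.
  by rewrite scalerN addNr -scalar_mx_block.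
apply/(reflexive_mxP WA); rewrite modF2_wirth_mx; apply/submxP; exists (const_mx 1).
by rewrite mul_mx_row oddC mulmx1 row_mx_const.
Qed.

Lemma wirth_reflexive n (A : 'M[int]_n) : wirth A -> reflexive_mx A.
Proof. by move/wirthP; case: n A / => f m C _; apply: reflexive_wirth_mx. Qed.

Lemma reflexive_wirth_form n (V : 'M[int]_n) : (0 < n)%N -> reflexive_mx V ->
  exists B A (s : {perm 'I_n}), [/\ B \in unitmx, wirth A & V *m perm_mx s = B *m A].
Proof.
move=> n0 rV; have [m rankV] : exists m, \rank (modF2 V) = m by eexists.
have m0 : (0 < m)%N.
  case: (rV) => [[W WV] _]; have /(reflexive_mxP WV) := rV.
  rewrite lt0n -rankV mxrank_eq0; apply: contraTneq => ->; rewrite submx0.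
  by apply/eqP => /rowP /(_ (Ordinal n0)) /eqP; rewrite !mxE oner_eq0.
have [f nE] : exists f, n = (f + m)%N by exists (n - m)%N; rewrite -rankV subnK ?rank_leq_row.
subst n; have [s [C eqVC]] := systematic_form rankV.
have rVs := reflexive_perm s rV; case: (rVs) => [[W WV] _].
have eqVsC : (modF2 (V *m perm_mx s) :=: row_mx C 1%:M)%MS by rewrite modF2M modF2_perm.
have oddC : odd_columns C.
  have /(reflexive_mxP WV) := rVs; rewrite eqVsC => /submxP [z].
  rewrite mul_mx_row mulmx1 -row_mx_const => /eq_row_mx [zC z1].
  by rewrite /odd_columns z1 -zC.
have [[W' WA] _] := reflexive_wirth_mx oddC.
have [|B uB VB] := modF2_eqmx_unit_mul WA WV.
  exact: eqmx_trans (modF2_wirth_mx C) (eqmx_sym eqVsC).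
by exists B, (wirth_mx C), s; split=> //; apply/wirthP.
Qed.

Lemma wirth_mx_1min f m (C : 'M['F_2]_(m, f)) :
  (0 < m)%N -> odd_columns C -> (forall i, row i C != 0) -> wirth_1min (wirth_mx C).
Proof.
move=> m0 oddC C0; exists f; split; first by apply/wirth_fP; exists C.
move=> i; case: (split_ordP i) => k ->; first by rewrite leqNgt /= ltn_ord.
have /rV0Pn [j] := C0 k; rewrite mxE => Ckj _; exists (lshift m j).
by rewrite block_mxEdl mxE Ckj /=.
Qed.

Lemma wirth_1minP n (A : 'M[int]_n) : wirth A ->
  wirth_1min A <-> forall j, ~~ ((delta_mx 0 j : 'rV_n) <= modF2 A)%MS.
Proof.
move=> wA; split=> [[f [wAf A_min]] j|no_unit]; last first.
  move/wirthP: wA no_unit; case: n A / => f m C m0 oddC no_unit.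
  apply: wirth_mx_1min => // i; apply: contraNneq (no_unit (rshift f i)) => Ci0.
  by rewrite modF2_wirth_mx; apply/delta_sub_systematic; exists i.
have [m nE] := wirth_f_addn wAf; subst n.
have [C [_ _ AE]] := (wirth_fP A).1 wAf; apply/negP.
rewrite AE modF2_wirth_mx => /delta_sub_systematic [i _ Ci0].
have [|j' [lt_j'f]] := A_min (rshift f i); first exact: leq_addr.
rewrite AE; case: (split_ordP j') lt_j'f => k -> // _.
by rewrite block_mxEdl mxE; move/rowP/(_ k): Ci0; rewrite !mxE => ->.
Qed.

(** * The reduction of a Wirth matrix *)

Definition nonzero_rows f m (C : 'M['F_2]_(m, f)) : {set 'I_m} := [set i | row i C != 0].

Definition drop_zero_rows f m (C : 'M['F_2]_(m, f)) : 'M_(#|nonzero_rows C|, f) :=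
  rowsub (@enum_val _ (mem (nonzero_rows C))) C.

Lemma odd_columns_drop_zero_rows f m (C : 'M['F_2]_(m, f)) :
  odd_columns C -> odd_columns (drop_zero_rows C).
Proof.
move=> oddC; rewrite /odd_columns -oddC; apply/rowP=> j; rewrite !mxE.
under eq_bigr do rewrite !mxE mul1r.
rewrite -(big_enum_val (fun i => C i j)) big_mkcond; apply: eq_bigr => i _ /=.
rewrite mxE mul1r inE; case: eqP => //= /rowP /(_ j).
by rewrite !mxE.
Qed.

Lemma row_drop_zero_rows f m (C : 'M['F_2]_(m, f)) i : row i (drop_zero_rows C) != 0.
Proof. by rewrite row_rowsub; have := enum_valP i; rewrite inE. Qed.

Lemma enum_set_lshift_rshift f m (K : {set 'I_(f + m)}) (T : {set 'I_m}) :
  (forall i, lshift m i \in K) -> (forall i, (rshift f i \in K) = (i \in T)) ->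
  enum K = [seq lshift m i | i <- enum 'I_f] ++ [seq rshift f i | i <- enum T].
Proof.
move=> lK rK; have -> : enum K = [seq i <- enum 'I_(f + m) | i \in K] by rewrite [in RHS]enumT.
have -> : enum 'I_(f + m) = [seq lshift m i | i <- enum 'I_f] ++ [seq rshift f i | i <- enum 'I_m].
  apply: (inj_map val_inj); rewrite map_cat val_enum_ord iotaD.
  congr (_ ++ _); first by rewrite -val_enum_ord -[RHS]map_comp.
  by rewrite addnC iotaDl -val_enum_ord -[LHS]map_comp -[RHS]map_comp.
rewrite filter_cat; congr (_ ++ _); rewrite filter_map; congr map.
  by apply/all_filterP/allP => i _; apply: lK.
by rewrite [in LHS]enumT; apply: eq_filter.
Qed.

Lemma enum_val_lshift_rshift f m (K : {set 'I_(f + m)}) (T : {set 'I_m})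
    (e : (f + #|T|)%N = #|K|) :
  (forall i, lshift m i \in K) -> (forall i, (rshift f i \in K) = (i \in T)) ->
  (forall j, enum_val (cast_ord e (lshift _ j)) = lshift m j) /\
  (forall k, enum_val (cast_ord e (rshift f k)) = rshift f (enum_val k)).
Proof.
move=> lK rK; have enumK := enum_set_lshift_rshift lK rK.
split=> [j|k]; first set x0 := enum_val _; last set x0 := enum_val (cast_ord _ _).
  rewrite /x0 (enum_val_nth x0) enumK nth_cat size_map size_enum_ord /= ltn_ord.
  by rewrite (nth_map j) ?size_enum_ord // nth_ord_enum.
rewrite /x0 (enum_val_nth x0) enumK nth_cat size_map size_enum_ord /= ltnNge leq_addr addKn.
by rewrite (nth_map (enum_val k)) -?enum_val_nth // -cardE.
Qed.

Section Reduction.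
Variables (f m : nat) (C : 'M['F_2]_(m, f)).

Lemma single_one_lshift i : single_one (wirth_mx C) (lshift m i) = false.
Proof.
rewrite /single_one (_ : [set j | _] = set0) ?cards0 //; apply/setP=> j; rewrite !inE.
case: (split_ordP j) => k ->; first by rewrite block_mxEul !mxE; case: (i == k).
by rewrite block_mxEur mxE.
Qed.

Lemma single_one_rshift i : single_one (wirth_mx C) (rshift f i) = (row i C == 0).
Proof.
apply/cards1P/eqP=> [[k /setP kP]|/rowP Ci0]; last first.
  exists (rshift f i); apply/setP=> j; rewrite !inE; case: (split_ordP j) => k ->.
    by rewrite block_mxEdl eq_lrshift mxE; move: (Ci0 k); rewrite !mxE => ->.
  by rewrite block_mxEdr mxE (inj_eq (@rshift_inj f m)) (eq_sym k); case: (i == k).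
have := kP (rshift f i); rewrite !inE block_mxEdr mxE !eqxx => /esym/eqP ik.
apply/rowP=> j; have := kP (lshift m j); rewrite !inE -ik eq_lrshift block_mxEdl !mxE.
by case: (eqVneq (C i j) 0).
Qed.

Lemma mem_kept_lshift i : lshift m i \in kept (wirth_mx C).
Proof. by rewrite inE single_one_lshift. Qed.

Lemma mem_kept_rshift i : (rshift f i \in kept (wirth_mx C)) = (i \in nonzero_rows C).
Proof. by rewrite !inE single_one_rshift. Qed.

Lemma reduction_wirth_mx :
  exists e : (f + #|nonzero_rows C|)%N = #|kept (wirth_mx C)|,
    reduction (wirth_mx C) = castmx (e, e) (wirth_mx (drop_zero_rows C)).
Proof.
have enumK := enum_set_lshift_rshift mem_kept_lshift mem_kept_rshift.
have e : (f + #|nonzero_rows C|)%N = #|kept (wirth_mx C)|.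
  by rewrite [RHS]cardE enumK size_cat size_map size_enum_ord size_map -cardE.
have [enum_valL enum_valR] := enum_val_lshift_rshift e mem_kept_lshift mem_kept_rshift.
exists e; apply/matrixP=> i' j'; rewrite -[i'](cast_ordKV e) -[j'](cast_ordKV e).
move: (cast_ord _ i') (cast_ord _ j') => i j; rewrite mxE castmxE !cast_ordK.
case: (split_ordP i) => k ->; case: (split_ordP j) => l ->; rewrite ?enum_valL ?enum_valR.
- by rewrite !block_mxEul !mxE.
- by rewrite !block_mxEur !mxE.
- by rewrite !block_mxEdl !mxE.
- by rewrite !block_mxEdr !mxE (inj_eq enum_val_inj).
Qed.
End Reduction.

Lemma reflexive_reduction n (A : 'M[int]_n) : wirth A -> reflexive_mx (reduction A).
Proof.
move/wirthP; case: n A / => f m C _ oddC; have [e ->] := reduction_wirth_mx C.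
by case: _ / e; rewrite castmx_id; apply/reflexive_wirth_mx/odd_columns_drop_zero_rows.
Qed.

Lemma reduction_1min n (A : 'M[int]_n) : wirth A -> (0 < #|kept A|)%N -> wirth_1min (reduction A).
Proof.
move/wirthP; case: n A / => f m C _ oddC; have [e ->] := reduction_wirth_mx C.
have oddC' := odd_columns_drop_zero_rows oddC.
case: _ / e => fm'0; rewrite castmx_id; apply: wirth_mx_1min => //; last exact: row_drop_zero_rows.
case: (posnP #|nonzero_rows C|) => // m'0; case: (posnP f) => [f0|f0].
  by rewrite m'0 addn0 f0 in fm'0.
by have := odd_columns_gt0 f0 oddC'; rewrite m'0.
Qed.

Lemma wirth_1min_num_single n (A : 'M[int]_n) : wirth A -> num_single A = 0%N -> wirth_1min A.
Proof.
move/wirthP; case: n A / => f m C m0 oddC /cards0_eq /setP single0.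
apply: wirth_mx_1min => // i; rewrite -single_one_rshift.
by have := single0 (rshift f i); rewrite !inE => ->.
Qed.

Lemma wirth_reorder n (A : 'M[int]_n) : wirth A ->
  exists2 phi : 'I_(num_single A + #|kept A|) -> 'I_n, bijective phi &
    mxsub phi phi A = unit_ext (num_single A) (reduction A).
Proof.
move/wirthP; case: n A / => f m C _ _.
have setU : [set i | single_one (wirth_mx C) i] = ~: kept (wirth_mx C).
  by apply/setP=> i; rewrite !inE negbK.
have [i j|i j|phi bij_phi phiE] := unit_ext_reorder (A := wirth_mx C) setU.
- rewrite inE; case: (split_ordP i) => k ->; first by rewrite single_one_lshift.
  rewrite single_one_rshift => /eqP /rowP Ck0; case: (split_ordP j) => l ->.
    by rewrite block_mxEdl eq_rlshift !mxE; move: (Ck0 l); rewrite !mxE => ->.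
  by rewrite block_mxEdr mxE (inj_eq (@rshift_inj f m)).
- rewrite inE; case: (split_ordP j) => l ->; first by rewrite single_one_lshift.
  case: (split_ordP i) => k -> _; first by rewrite block_mxEur mxE eq_lrshift.
  by rewrite block_mxEdr mxE (inj_eq (@rshift_inj f m)).
by exists phi.
Qed.

(** * Convex hulls *)

Section ConvexSets.
Variable R : realType.
Implicit Types n : nat.

Lemma conv_set_sum n (S : 'cV[R]_n -> Prop) (I : finType) (p : I -> 'cV[R]_n) (w : I -> R) :
  (forall i, S (p i)) -> (forall i, 0 <= w i) -> \sum_i w i = 1 ->
  conv_set S (\sum_i w i *: p i).
Proof.
move=> Sp w0 w1; exists #|I|, (p \o enum_val), (w \o enum_val); split=> [i|] /=.
  exact: Sp.
split=> [i|]; first exact: w0.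
by rewrite -w1 -(big_enum_val w) -(big_enum_val (fun i => w i *: p i)).
Qed.

Lemma mem_conv_set n (S : 'cV[R]_n -> Prop) x : S x -> conv_set S x.
Proof.
move=> Sx; have := @conv_set_sum _ S unit (fun=> x) (fun=> 1) (fun=> Sx) (fun=> ler01).
by rewrite !big_const card_unit /= !addr0 scale1r; apply.
Qed.

Definition convex n (C : 'cV[R]_n -> Prop) := forall x y (t : R),
  C x -> C y -> 0 <= t <= 1 -> C (t *: x + (1 - t) *: y).

Lemma convex_conv_set n (S : 'cV[R]_n -> Prop) : convex (conv_set S).
Proof.
move=> _ _ t [k [p [w [Sp [w0 [w1 ->]]]]]] [l [q [v [Sq [v0 [v1 ->]]]]]] /andP[t0 t1].
have := @conv_set_sum _ S ('I_k + 'I_l)%type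
  (fun i => match i with inl a => p a | inr b => q b end)
  (fun i => match i with inl a => t * w a | inr b => (1 - t) * v b end).
rewrite !big_sumType /= -!mulr_sumr w1 v1 !scaler_sumr.
under [X in conv_set _ (X + _)]eq_bigr do rewrite -scalerA.
under [X in conv_set _ (_ + X)]eq_bigr do rewrite -scalerA.
apply; [by case | | lra].
by case=> a; apply: mulr_ge0 => //; lra.
Qed.

Lemma convex_cone n (C : 'cV[R]_n -> Prop) x y (a b : R) : convex C -> C x -> C y ->
  0 <= a -> 0 <= b -> exists2 z, C z & a *: x + b *: y = (a + b) *: z.
Proof.
move=> cC Cx Cy a0 b0; have [ab0|ab0] := eqVneq (a + b) 0.
  have [-> ->] : a = 0 /\ b = 0 by split; lra.
  by exists x; rewrite // addr0 !scale0r addr0.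
have abp : 0 < a + b by rewrite lt_neqAle eq_sym ab0 addr_ge0.
exists ((a / (a + b)) *: x + (1 - a / (a + b)) *: y).
  by apply: cC => //; rewrite divr_ge0 ?ler_pdivrMr ?mul1r ?(ltW abp) //; lra.
by rewrite scalerDr !scalerA; congr (_ *: _ + _ *: _); field.
Qed.

Lemma conv_set_min n (S C : 'cV[R]_n -> Prop) x : convex C -> (forall y, S y -> C y) ->
  conv_set S x -> C x.
Proof.
move=> cC SC [[|k] [p [w [Sp [w0 [w1 ->]]]]]].
  by move/eqP: w1; rewrite big_ord0 eq_sym oner_eq0.
pose cone (v : 'cV_n) (a : R) := 0 <= a /\ exists2 z, C z & v = a *: z.
have [_ [z Cz ->]] : cone (\sum_i w i *: p i) (\sum_i w i).
  apply: (big_ind2 cone) => [|v a v' a' [a0 [z Cz ->]] [a'0 [z' Cz' ->]]|i _].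
  - by split=> //; exists (p ord0); [apply: SC | rewrite scale0r].
  - split; first exact: addr_ge0.
    by have [y Cy ->] := convex_cone cC Cz Cz' a0 a'0; exists y.
  - by split=> //; exists (p i); first exact: SC.
by rewrite w1 scale1r.
Qed.

Lemma conv_set_mono n (S S' : 'cV[R]_n -> Prop) x : (forall y, S y -> S' y) ->
  conv_set S x -> conv_set S' x.
Proof.
by move=> SS'; apply: conv_set_min; [exact: convex_conv_set | move=> y /SS' /mem_conv_set].
Qed.

Lemma lattice_polytope_convex n (P : 'cV[R]_n -> Prop) : lattice_polytope P -> convex P.
Proof.
by move=> [s Ps] x y t /Ps Px /Ps Py t01; apply/Ps; apply: convex_conv_set.
Qed.

Lemma zero_interior0 n (P : 'cV[R]_n -> Prop) : zero_interior P -> P 0.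
Proof. by move=> [e [e0]]; apply => i; rewrite mxE normr0 ltW. Qed.

Lemma vertex_conv_set n (S : 'cV[R]_n -> Prop) x : vertex (conv_set S) x -> S x.
Proof.
move=> [Px extx]; suff [_] : conv_set S x /\ (x = x -> S x) by apply.
apply: (@conv_set_min _ S (fun y => conv_set S y /\ (y = x -> S x))) Px => [a b t|y Sy]; last first.
  by split=> [|<-//]; apply: mem_conv_set.
move=> [Pa Sa] [Pb Sb] t01; split; first exact: convex_conv_set.
have [->|t0] := eqVneq t 0; first by rewrite scale0r add0r subr0 scale1r.
have [->|t1] := eqVneq t 1; first by rewrite subrr scale0r addr0 scale1r.
have t_in : 0 < t < 1 by rewrite !lt_neqAle t1 eq_sym t0.
move=> abx; have ab := extx a b t Pa Pb t_in (esym abx); apply: Sb.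
by rewrite -abx ab -scalerDl addrC subrK scale1r.
Qed.

Lemma vertex_same n (P Q : 'cV[R]_n -> Prop) x : same P Q -> vertex P x <-> vertex Q x.
Proof.
move=> PQ; split=> - [Px extx]; split; try exact/PQ.
  by move=> y z t /PQ Py /PQ Pz; apply: extx.
by move=> y z t /PQ Py /PQ Pz; apply: extx.
Qed.

Lemma vertex_mulmx n m (U : 'M[R]_(m, n)) (V : 'M_(n, m))
    (P : 'cV_n -> Prop) (Q : 'cV_m -> Prop) x :
  V *m U = 1%:M -> U *m V = 1%:M -> (forall x, P x <-> Q (U *m x)) ->
  vertex P x <-> vertex Q (U *m x).
Proof.
move=> VU UV PQ; split=> - [Px extx]; split; try exact/PQ.
  move=> y z t; rewrite -[y]mul1mx -[z]mul1mx -UV -!mulmxA => /PQ Py /PQ Pz t01 xE.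
  congr (_ *m _); apply: (extx _ _ t) => //.
  by rewrite -[LHS]mul1mx -VU -mulmxA xE mulmxDr -!scalemxAr !(mulmxA V U) VU !mul1mx.
move=> y z t /PQ Qy /PQ Qz t01 xE; rewrite -[y]mul1mx -[z]mul1mx -VU -!mulmxA; congr (_ *m _).
by apply: (extx _ _ t) => //; rewrite xE mulmxDr -!scalemxAr.
Qed.

Lemma zero_interior_vertex0 n (P : 'cV[R]_n -> Prop) :
  zero_interior P -> vertex P 0 -> n = 0%N.
Proof.
move=> [e [e0 eP]] [_ ext0]; case: (posnP n) => // n0.
have Pe (b : bool) : P (const_mx ((-1) ^+ b * e)).
  by apply: eP => i; rewrite mxE normrM normr_sign mul1r gtr0_norm.
have /(_ ltac:(lra)) := ext0 _ _ 2^-1 (Pe false) (Pe true).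
set mid := _ + _; have -> : mid = 0 by apply/colP=> i; rewrite !mxE expr0 expr1; lra.
move=> /(_ erefl) /colP /(_ (Ordinal n0)); rewrite !mxE expr0 expr1 => e_eqN.
by exfalso; lra.
Qed.

Lemma convex_comb_extreme (t a b s : R) : 0 < t < 1 -> `|a| <= 1 -> `|b| <= 1 -> `|s| = 1 ->
  s = t * a + (1 - t) * b -> a = s /\ b = s.
Proof.
move=> /andP[t0 t1]; rewrite !ler_norml => /andP[a0 a1] /andP[b0 b1] s1 sE.
move: s1; case: (ger0P s) => s0 s1.
  by have [-> ->] : a = 1 /\ b = 1; [split; nra | lra].
by have [-> ->] : a = -1 /\ b = -1; [split; nra | lra].
Qed.
End ConvexSets.

(** * Crosspolytopes *)

Section IntegralMatrices.
Variable R : realType.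

Lemma toRM m n p (A : 'M[int]_(m, n)) (B : 'M[int]_(n, p)) :
  toR R (A *m B) = toR R A *m toR R B.
Proof. exact: (map_mxM (intr : {rmorphism int -> R})). Qed.

Lemma toR1 n : toR R 1%:M = 1%:M :> 'M_n.
Proof. exact: (map_mx1 (intr : {rmorphism int -> R})). Qed.

Lemma toR0 m n : toR R 0 = 0 :> 'M_(m, n).
Proof. exact: (map_mx0 (intr : {rmorphism int -> R})). Qed.

Lemma toR_dsum m n m' n' (A : 'M[int]_(m, n)) (B : 'M_(m', n')) :
  toR R (dsum_mx A B) = dsum_mx (toR R A) (toR R B).
Proof. by rewrite /toR map_block_mx -!/(toR R _) !toR0. Qed.

Lemma toR_sign m n (b : bool) (A : 'M[int]_(m, n)) :
  toR R ((-1) ^+ b *: A) = (-1) ^+ b *: toR R A.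
Proof. by apply/matrixP=> i j; rewrite !mxE rmorphM /= rmorph_sign. Qed.

Lemma toR_inj m n : injective (@toR R m n).
Proof.
move=> A B /matrixP AB; apply/matrixP=> i j; move: (AB i j); rewrite !mxE.
exact: intr_inj.
Qed.

Lemma toR_unit n (X : 'M[int]_n) : \det X != 0 -> toR R X \in unitmx.
Proof.
by rewrite unitmxE unitfE (_ : \det (toR R X) = (\det X)%:~R) ?intr_eq0 // -det_map_mx.
Qed.

Lemma toR_mulK m n p (U : 'M[int]_(m, n)) (V : 'M_(n, m)) (x : 'M[R]_(n, p)) :
  V *m U = 1%:M -> toR R V *m (toR R U *m x) = x.
Proof. by move=> VU; rewrite mulmxA -toRM VU toR1 mul1mx. Qed.

Lemma toR_mulmx_inj n p (X : 'M[int]_n) : \det X != 0 ->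
  injective (fun t : 'M[R]_(n, p) => toR R X *m t).
Proof. by move=> /toR_unit uX; apply: can_inj (mulKmx uX). Qed.
End IntegralMatrices.

Section L1Ball.
Variable R : realType.
Implicit Types n : nat.

Definition l1norm n (t : 'cV[R]_n) : R := \sum_i `|t i 0|.

Definition l1_ball n (t : 'cV[R]_n) := l1norm t <= 1.

Lemma convex_l1_ball n : convex (@l1_ball n).
Proof.
move=> x y t x1 y1 /andP[t0 t1]; rewrite /l1_ball in x1 y1 *.
have : l1norm (t *: x + (1 - t) *: y) <= t * l1norm x + (1 - t) * l1norm y.
  rewrite /l1norm !mulr_sumr -big_split /=; apply: ler_sum => i _; rewrite !mxE.
  by rewrite (le_trans (ler_normD _ _)) // !normrM (ger0_norm t0) (@ger0_norm _ (1 - t)) ?subr_ge0.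
move/le_trans; apply; nra.
Qed.

Lemma l1norm0 n : l1norm (0 : 'cV[R]_n) = 0.
Proof. by rewrite /l1norm big1 // => i _; rewrite mxE normr0. Qed.

Lemma ler_norm_l1norm n (t : 'cV[R]_n) j : `|t j 0| <= l1norm t.
Proof. by rewrite /l1norm (bigD1 j) //= lerDl sumr_ge0. Qed.

Lemma l1norm_sign_delta n (j : 'I_n) (b : bool) : l1norm ((-1) ^+ b *: delta_mx j 0) = 1.
Proof.
rewrite /l1norm (bigD1 j) //= big1 ?addr0 => [|i ij]; rewrite !mxE ?eqxx ?mulr1 ?normr_sign //.
by rewrite (negPf ij) mulr0 normr0.
Qed.

Lemma l1norm_rowsub n m (phi : 'I_m -> 'I_n) (t : 'cV[R]_n) : bijective phi ->
  l1norm (rowsub phi t) = l1norm t.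
Proof.
move=> bij_phi; rewrite /l1norm [RHS](reindex phi); last exact: onW_bij.
by apply: eq_bigr => i _; rewrite mxE.
Qed.

Lemma l1_ball_extreme n (t : 'cV[R]_n) j (b : bool) : l1_ball t -> t j 0 = (-1) ^+ b ->
  t = (-1) ^+ b *: delta_mx j 0.
Proof.
rewrite /l1_ball /l1norm (bigD1 j) //= => t1 tj; rewrite tj normr_sign in t1.
have /psumr_eq0P rest0 : \sum_(i < n | i != j) `|t i 0| = 0.
  by apply/eqP; rewrite eq_le sumr_ge0 // andbT; lra.
apply/colP=> i; rewrite !mxE eqxx andbT; have [->|ij] := eqVneq i j; first by rewrite mulr1.
by rewrite mulr0; apply/normr0_eq0/rest0.
Qed.

Lemma vertex_l1_ball_sign_delta n (j : 'I_n) (b : bool) :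
  vertex (@l1_ball n) ((-1) ^+ b *: delta_mx j 0).
Proof.
split=> [|y z t y1 z1 t01 /colP /(_ j)]; first by rewrite /l1_ball l1norm_sign_delta.
rewrite !mxE !eqxx mulr1 => bE.
have [|||yj zj] := convex_comb_extreme t01 _ _ _ bE; rewrite ?normr_sign //.
- exact: le_trans (ler_norm_l1norm y j) y1.
- exact: le_trans (ler_norm_l1norm z j) z1.
by rewrite (l1_ball_extreme y1 yj) (l1_ball_extreme z1 zj).
Qed.
End L1Ball.

Section CrossPolytopes.
Variable R : realType.
Implicit Types n m : nat.

Definition signed_col n (X : 'M[int]_n) (j : 'I_n) (b : bool) : 'cV[R]_n :=
  (-1) ^+ b *: toR R (col j X).

Lemma signed_colF n (X : 'M[int]_n) j : signed_col X j false = toR R (col j X).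
Proof. exact: scale1r. Qed.

Lemma signed_colE n (X : 'M[int]_n) j b :
  signed_col X j b = toR R X *m ((-1) ^+ b *: delta_mx j 0).
Proof.
by rewrite -scalemxAr -colE; congr (_ *: _); apply/matrixP=> i k; rewrite !mxE.
Qed.

Lemma signed_col_inj n (X : 'M[int]_n) j k b c : \det X != 0 ->
  signed_col X j b = signed_col X k c -> j = k.
Proof.
move=> dX; rewrite !signed_colE => /(toR_mulmx_inj dX) /colP /(_ j) /eqP.
by rewrite !mxE !eqxx; case: (eqVneq j k) => //= _; rewrite mulr0 mulr1 signr_eq0.
Qed.

Lemma signed_colZ n (X : 'M[int]_n) j (c b : bool) :
  (-1) ^+ c *: signed_col X j b = signed_col X j (c (+) b).
Proof. by rewrite scalerA -signr_addb. Qed.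

Lemma signed_col_modF2 n (X Y : 'M[int]_n) j k b c :
  signed_col X j b = signed_col Y k c -> modF2 (col j X) = modF2 (col k Y).
Proof.
rewrite /signed_col -!toR_sign => /toR_inj /(congr1 (@modF2 _ _)).
by rewrite !modF2_sign.
Qed.

Lemma signed_col_mull n (U X : 'M[int]_n) j b :
  signed_col (U *m X) j b = toR R U *m signed_col X j b.
Proof. by rewrite !signed_colE mulmxA toRM. Qed.

Lemma Pmx_generatorsP n (X : 'M[int]_n) y :
  y \in (0 :: [seq toR R (col j X) | j <- enum 'I_n]
           ++ [seq - toR R (col j X) | j <- enum 'I_n]) <->
  y = 0 \/ exists j b, y = signed_col X j b.
Proof.
rewrite inE mem_cat; split=> [/orP[/eqP->|/orP[]]|[->|[j [b ->]]]].
- by left.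
- by case/mapP=> j _ ->; right; exists j, false; rewrite signed_colF.
- by case/mapP=> j _ ->; right; exists j, true; rewrite /signed_col scaleN1r.
- by rewrite eqxx.
- rewrite /signed_col; case: b; rewrite ?scaleN1r ?scale1r; apply/orP; right; apply/orP;
  [right | left]; exact/map_f/mem_enum.
Qed.

Lemma Pmx_signed_col n (X : 'M[int]_n) j b : Pmx R X (signed_col X j b).
Proof. by apply: mem_conv_set; apply/Pmx_generatorsP; right; exists j, b. Qed.

Lemma PmxP n (X : 'M[int]_n) x :
  Pmx R X x <-> exists2 t, l1_ball t & x = toR R X *m t.
Proof.
pose ball_image x := exists2 t, l1_ball t & x = toR R X *m t.
split=> [|[t t1 ->]].
  apply: (conv_set_min (C := ball_image)) => [_ _ a [s s1 ->] [t t1 ->] a01|y].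
  - exists (a *: s + (1 - a) *: t); first exact: convex_l1_ball.
    by rewrite mulmxDr -!scalemxAr.
  - case/Pmx_generatorsP => [->|[j [b ->]]].
      by exists 0; rewrite ?mulmx0 // /l1_ball l1norm0.
    exists ((-1) ^+ b *: delta_mx j 0); last exact: signed_colE.
    by rewrite /l1_ball l1norm_sign_delta.
pose p (o : 'I_1 + 'I_n) := if o is inr j then signed_col X j (t j 0 < 0) else 0.
pose w (o : 'I_1 + 'I_n) := if o is inr j then `|t j 0| else 1 - l1norm t.
have -> : toR R X *m t = \sum_o w o *: p o.
  rewrite big_sumType big_ord1 /= scaler0 add0r [t in LHS]matrix_sum_delta mulmx_sumr.
  apply: eq_bigr => j _; rewrite big_ord1 signed_colE scalemxAr scalerA; congr (_ *m (_ *: _)).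
  by rewrite mulrC -numEsign.
apply: conv_set_sum => [[_|j]|[_|j]|] /=.
- by apply/Pmx_generatorsP; left.
- by apply/Pmx_generatorsP; right; exists j, (t j 0 < 0).
- by rewrite subr_ge0.
- exact: normr_ge0.
- by rewrite big_sumType big_ord1 /= subrK.
Qed.

Lemma Pmx_mulmx n (X : 'M[int]_n) t : \det X != 0 -> Pmx R X (toR R X *m t) <-> l1_ball t.
Proof.
move=> dX; split=> [/PmxP [s s1 /(toR_mulmx_inj dX) ->] //|t1].
by apply/PmxP; exists t.
Qed.

Lemma zero_interior_Pmx n (X : 'M[int]_n) : \det X != 0 -> zero_interior (Pmx R X).
Proof.
move=> dX; pose Y := invmx (toR R X); pose c := \sum_j \sum_i `|Y j i|.
have c0 : 0 <= c by do 2!(apply: sumr_ge0 => ? _).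
exists (1 + c)^-1; split=> [|x x_small]; first by rewrite invr_gt0; lra.
rewrite -[x](mulKVmx (toR_unit R dX)); apply/(Pmx_mulmx _ dX).
apply: (@le_trans _ _ (c / (1 + c))); last by rewrite ler_pdivrMr ?mul1r; lra.
rewrite /l1norm /c mulr_suml; apply: ler_sum => j _; rewrite mulr_suml mxE.
apply: le_trans (ler_norm_sum _ _ _) _; apply: ler_sum => i _.
by rewrite normrM ler_wpM2l.
Qed.

Lemma lattice_polytope_Pmx n (X : 'M[int]_n) : lattice_polytope (Pmx R X).
Proof.
exists (0 :: [seq col j X | j <- enum 'I_n] ++ [seq - col j X | j <- enum 'I_n]) => x.
rewrite /= map_cat -2!map_comp /Pmx toR0.
have -> : [seq - toR R (col j X) | j <- enum 'I_n] =
    [seq (toR R \o (fun j => - col j X)) i | i <- enum 'I_n].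
  by apply: eq_map => j; apply/colP=> i; rewrite !mxE rmorphN.
exact: iff_refl.
Qed.

Lemma vertex_Pmx n (X : 'M[int]_n) x : \det X != 0 ->
  vertex (Pmx R X) x <-> n = 0%N \/ exists j b, x = signed_col X j b.
Proof.
move=> dX; have uX := toR_unit R dX; split=> [vx|[n0|[j [b ->]]]].
- have /Pmx_generatorsP [x0|] := vertex_conv_set vx; last by right.
  by left; apply: zero_interior_vertex0 (zero_interior_Pmx dX) _; rewrite -x0.
- subst n; split=> [|y z t _ _ _ _]; last by rewrite (flatmx0 y) (flatmx0 z).
  by apply: mem_conv_set; rewrite (flatmx0 x) inE eqxx.
rewrite signed_colE -(@vertex_mulmx _ _ _ _ (invmx (toR R X)) (@l1_ball R n)).
- exact: vertex_l1_ball_sign_delta.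
- exact: mulVmx.
- exact: mulmxV.
- by move=> t; rewrite Pmx_mulmx.
Qed.

Lemma Pmx_mono n (X X' : 'M[int]_n) x :
  (forall j b, exists k c, signed_col X' j b = signed_col X k c) ->
  Pmx R X' x -> Pmx R X x.
Proof.
move=> colX'; apply: conv_set_mono => y /Pmx_generatorsP [->|[j [b ->]]].
  by apply/Pmx_generatorsP; left.
by apply/Pmx_generatorsP; right; apply: colX'.
Qed.
End CrossPolytopes.

(** * Isomorphisms *)

Section Isomorphisms.
Variable R : realType.
Implicit Types n m p : nat.

Lemma iso_linear n m (U : 'M[int]_(m, n)) (V : 'M_(n, m)) (P : 'cV[R]_n -> Prop) Q :
  V *m U = 1%:M -> U *m V = 1%:M -> (forall x, P x <-> Q (toR R U *m x)) -> iso P Q.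
Proof.
move=> VU UV PQ; have vPQ x : vertex P x <-> vertex Q (toR R U *m x).
  by apply: (vertex_mulmx (V := toR R V)) PQ; rewrite -toRM ?VU ?UV toR1.
exists U, V; do 2!split=> //; split=> [x /vPQ //|y vy].
by exists (toR R V *m y); rewrite vPQ toR_mulK.
Qed.

Lemma iso_same n (P Q : 'cV[R]_n -> Prop) : same P Q -> iso P Q.
Proof.
by move=> PQ; apply: (@iso_linear _ _ 1%:M 1%:M) => [||x]; rewrite ?mulmx1 ?toR1 ?mul1mx.
Qed.

Lemma iso_refl n (P : 'cV[R]_n -> Prop) : iso P P.
Proof. exact: iso_same. Qed.

Lemma iso_trans n m p (P : 'cV[R]_n -> Prop) (Q : 'cV[R]_m -> Prop) (S : 'cV[R]_p -> Prop) :
  iso P Q -> iso Q S -> iso P S.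
Proof.
move=> [U [V [VU [UV [PQ QP]]]]] [U' [V' [VU' [UV' [QS SQ]]]]].
exists (U' *m U), (V *m V'); split; last split; last split=> [x vx|y /SQ [x [/QP [z [vz ->]] ->]]].
- by rewrite mulmxA -(mulmxA V) VU' mulmx1.
- by rewrite mulmxA -(mulmxA U') UV mulmx1.
- by rewrite toRM -mulmxA; apply/QS/PQ.
- by exists z; rewrite toRM mulmxA.
Qed.

Lemma iso_sym n m (P : 'cV[R]_n -> Prop) (Q : 'cV[R]_m -> Prop) : iso P Q -> iso Q P.
Proof.
move=> [U [V [VU [UV [PQ QP]]]]]; exists V, U; do 2!split=> //; split=> [y /QP [x [vx ->]]|x vx].
  by rewrite toR_mulK.
by exists (toR R U *m x); rewrite toR_mulK //; split=> //; apply: PQ.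
Qed.

Lemma iso_dim n m (P : 'cV[R]_n -> Prop) (Q : 'cV[R]_m -> Prop) : iso P Q -> n = m.
Proof.
move=> [U [V [VU [UV _]]]]; apply/eqP; rewrite eqn_leq.
by rewrite (mulmx1_min VU) (mulmx1_min UV).
Qed.

Lemma iso_mul_colsub n m (X : 'M[int]_n) (U : 'M_(m, n)) (V : 'M_(n, m)) (phi : 'I_m -> 'I_n) :
  V *m U = 1%:M -> U *m V = 1%:M -> bijective phi ->
  iso (Pmx R X) (Pmx R (U *m colsub phi X)).
Proof.
move=> VU UV bij_phi; have [psi phiK psiK] := bij_phi.
have toR_colsub (t : 'cV[R]_n) :
    toR R (U *m colsub phi X) *m rowsub phi t = toR R U *m (toR R X *m t).
  by rewrite toRM -mulmxA {2}/toR map_mxsub mul_colsub_rowsub.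
apply: (iso_linear VU UV) => x; split=> /PmxP [t t1].
  move=> ->; apply/PmxP; exists (rowsub phi t); last by rewrite toR_colsub.
  by rewrite /l1_ball l1norm_rowsub.
have bij_psi : bijective psi by exists phi.
have -> : t = rowsub phi (rowsub psi t) by apply/matrixP=> i j; rewrite !mxE phiK.
rewrite toR_colsub => /(congr1 (mulmx (toR R V))); rewrite !toR_mulK // => ->.
by apply/PmxP; exists (rowsub psi t); rewrite // /l1_ball l1norm_rowsub.
Qed.

Lemma mx_equiv_iso n (X X' : 'M[int]_n) : mx_equiv X X' -> iso (Pmx R X) (Pmx R X').
Proof.
move=> [U [s [uU ->]]]; rewrite -mulmxA -[s]invgK -col_permE col_permEsub.
by apply: iso_mul_colsub (mulVmx uU) (mulmxV uU) _; exists s; [apply: permKV | apply: permK].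
Qed.

Lemma iso_unit_mul n (X B : 'M[int]_n) : B \in unitmx -> iso (Pmx R X) (Pmx R (B *m X)).
Proof. by move=> uB; apply/mx_equiv_iso/mx_equiv_mull. Qed.

Lemma iso_mxsub n m (X : 'M[int]_n) (phi : 'I_m -> 'I_n) : bijective phi ->
  iso (Pmx R X) (Pmx R (mxsub phi phi X)).
Proof.
move=> bij_phi; have -> : mxsub phi phi X = rowsub phi 1%:M *m colsub phi X.
  by rewrite mul_rowsub_mx mul1mx; apply/matrixP=> i j; rewrite !mxE.
apply: (@iso_mul_colsub _ _ X _ (colsub phi 1%:M)) => //.
  by rewrite mul_colsub_rowsub // mulmx1.
by rewrite mul_rowsub_mx mul1mx; apply/matrixP=> i j; rewrite !mxE (inj_eq (bij_inj bij_phi)).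
Qed.

Lemma iso_mx_equiv n (X X' : 'M[int]_n) :
  reflexive_mx X -> reflexive_mx X' -> iso (Pmx R X) (Pmx R X') -> mx_equiv X X'.
Proof.
move=> rX rX'; have dX := reflexive_det rX; have dX' := reflexive_det rX'.
move=> [U [V [VU [UV [_ X'X]]]]].
have uU : U \in unitmx := (mulmx1_unit UV).1.
have /fin_all_exists [g gE] (j : 'I_n) : exists kb : 'I_n * bool,
    signed_col R X' j false = signed_col R (U *m X) kb.1 kb.2.
  have /X'X [x [+ ->]] : vertex (Pmx R X') (signed_col R X' j false).
    by apply/vertex_Pmx => //; right; exists j, false.
  case/vertex_Pmx => // [n0|[k [b ->]]]; last by exists (k, b); rewrite signed_col_mull.
  by have := leq_ltn_trans (leq0n j) (ltn_ord j); rewrite {1}n0.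
have injg : injective (fun j => (g j).1).
  move=> j k /= gjk; apply: (@signed_col_inj R _ X' j k false ((g j).2 (+) (g k).2) dX').
  by rewrite -[_ (+) _]addbF -signed_colZ !gE gjk signed_colZ addbK.
apply/mx_equiv_modF2 => //; exists (perm injg)^-1%g.
have -> : modF2 X' = modF2 U *m (modF2 X *m perm_mx (perm injg)^-1).
  rewrite mulmxA -modF2M -col_permE; apply/matrixP=> i j.
  by have /colP /(_ i) := signed_col_modF2 (gE j); rewrite !mxE permE.
by apply: eqmx_sym; apply: eqmxMfull; rewrite row_full_unit modF2_unit.
Qed.
End Isomorphisms.

(** * Duality *)

Section Duality.
Variable R : realType.
Implicit Types n : nat.

Lemma pairE n (x y : 'cV[R]_n) : pair x y = (x^T *m y) 0 0.
Proof. by rewrite mxE; apply: eq_bigr => i _; rewrite mxE. Qed.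

Lemma pairDr n (x y z : 'cV[R]_n) (a b : R) :
  pair x (a *: y + b *: z) = a * pair x y + b * pair x z.
Proof. by rewrite !pairE mulmxDr -!scalemxAr !mxE. Qed.

Lemma pairDl n (x y z : 'cV[R]_n) (a b : R) :
  pair (a *: y + b *: z) x = a * pair y x + b * pair z x.
Proof. by rewrite !pairE linearD !linearZ /= mulmxDl -!scalemxAl !mxE. Qed.

Lemma pair_signed_col n (X : 'M[int]_n) (y : 'cV[R]_n) j b :
  pair y (signed_col R X j b) = (-1) ^+ b * (y^T *m toR R X) 0 j.
Proof. by rewrite pairE signed_colE mulmxA -scalemxAr mxE -colE mxE. Qed.

Lemma convex_dual n (P : 'cV[R]_n -> Prop) : convex (dual P).
Proof.
by move=> x y t Px Py t01 z Pz; rewrite pairDl; move: (Px z Pz) (Py z Pz) => *; nra.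
Qed.

Lemma norm_le_signP (a r : R) : `|a| <= r <-> forall b : bool, - r <= (-1) ^+ b * a.
Proof.
rewrite ler_norml; split=> [/andP[ra ar] []|ra]; rewrite ?expr0 ?expr1; try lra.
by move: (ra false) (ra true); rewrite expr0 expr1 => *; apply/andP; split; lra.
Qed.

Lemma dual_Pmx n (X : 'M[int]_n) (y : 'cV[R]_n) :
  dual (Pmx R X) y <-> forall j, `|(y^T *m toR R X) 0 j| <= 1.
Proof.
split=> [dy j|y1 z].
  by apply/norm_le_signP => b; rewrite -pair_signed_col; apply/dy/Pmx_signed_col.
apply: (@conv_set_min _ _ _ (fun z => -1 <= pair y z)) => [a b t *|{}z].
  by rewrite pairDr; nra.
case/Pmx_generatorsP => [->|[j [b ->]]]; first by rewrite pairE mulmx0 mxE lerN10.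
by rewrite pair_signed_col; move/norm_le_signP: (y1 j); apply.
Qed.

Lemma vertex_dual_Pmx n (X : 'M[int]_n) (y : 'cV[R]_n) : \det X != 0 ->
  (forall j, `|(y^T *m toR R X) 0 j| = 1) -> vertex (dual (Pmx R X)) y.
Proof.
move=> /(toR_unit R) uX y1; split=> [|a b t /dual_Pmx da /dual_Pmx db t01 yE].
  by apply/dual_Pmx => j; rewrite y1.
apply/trmx_inj/(can_inj (mulmxK uX)); apply/rowP=> j.
have [|-> -> //] := convex_comb_extreme t01 (da j) (db j) (y1 j).
by rewrite yE linearD !linearZ /= mulmxDl -!scalemxAl !mxE.
Qed.

(* The coefficients are those of the product distribution on the sign vectors whose marginals
   have mean [t i]. *)
Lemma cube_sign_comb n (t : 'I_n -> R) : (forall i, `|t i| <= 1) ->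
  exists w : {ffun 'I_n -> bool} -> R, [/\ forall e, 0 <= w e, \sum_e w e = 1 &
    forall k, \sum_e w e * (-1) ^+ e k = t k].
Proof.
move=> t1; pose F i (b : bool) : R := (1 + (-1) ^+ b * t i) / 2.
have F1 i : \sum_b F i b = 1.
  by rewrite big_bool /F expr1 expr0 /=; field.
exists (fun e => \prod_i F i (e i)); split=> [e||k].
- apply: prodr_ge0 => i _; have /norm_le_signP /(_ (e i)) := t1 i; rewrite /F; lra.
- by rewrite -(bigA_distr_bigA F) big1.
pose G i (b : bool) : R := F i b * (if i == k then (-1) ^+ b else 1).
transitivity (\sum_(e : {ffun 'I_n -> bool}) \prod_i G i (e i)).
  apply: eq_bigr => e _; rewrite [RHS]big_split /=; congr (_ * _).
  by rewrite [RHS](bigD1 k) //= eqxx big1 ?mulr1 // => i /negPf ->.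
rewrite -(bigA_distr_bigA G) (bigD1 k) //= [X in _ * X]big1 ?mulr1 => [|i ik].
  by rewrite big_bool /G /F eqxx expr1 expr0 /=; field.
by rewrite -[RHS](F1 i); apply: eq_bigr => b _; rewrite /G (negPf ik) mulr1.
Qed.

Lemma Fano_Pmx n (X : 'M[int]_n) : reflexive_mx X -> Fano (Pmx R X).
Proof.
move=> rX; have dX := reflexive_det rX; split; first exact: lattice_polytope_Pmx.
split=> [|x vx x0]; first exact: zero_interior_Pmx.
case/(vertex_Pmx _ dX): vx => [n0|[j [b xE]]]; first by subst n; rewrite (flatmx0 x) eqxx in x0.
exists ((-1) ^+ b *: col j X); split=> [|k w kw]; first by rewrite toR_sign.
case: rX => _ [u uX].
have : (u *m ((-1) ^+ b *: col j X)) 0 0 = (-1) ^+ b.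
  by rewrite -scalemxAr colE mulmxA uX -colE !mxE mulr1.
rewrite kw -scalemxAr mxE; set z := (u *m w) 0 0 => kz.
have {kz} : absz (k * z) = 1%N by rewrite kz; case: (b).
by rewrite abszM => /eqP; rewrite muln_eq1 => /andP[/eqP k1 _]; lia.
Qed.

Lemma reflexive_Pmx n (X : 'M[int]_n) : reflexive_mx X -> is_reflexive (Pmx R X).
Proof.
move=> rX; split; first exact: Fano_Pmx.
have uX := toR_unit R (reflexive_det rX).
have /fin_all_exists [y yX] (e : {ffun 'I_n -> bool}) : exists u : 'cV[int]_n,
    (toR R u)^T *m toR R X = \row_j (-1) ^+ e j.
  have [u uX'] := reflexive_odd_row rX (modF2_sign_row e); exists u^T.
  rewrite /toR map_trmx trmxK -/(toR R _) -toRM uX'.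
  by apply/rowP=> j; rewrite !mxE rmorph_sign.
exists [seq y e | e : {ffun 'I_n -> bool}] => x; split.
  move/dual_Pmx => /cube_sign_comb [w [w0 w1 wk]].
  have -> : x = \sum_e w e *: toR R (y e).
    apply/trmx_inj/(can_inj (mulmxK uX))/rowP => k.
    rewrite -wk linear_sum mulmx_suml summxE; apply: eq_bigr => e _.
    by rewrite linearZ /= -scalemxAl yX !mxE.
  by apply: conv_set_sum => // e; apply/map_f/image_f.
apply: conv_set_min (@convex_dual _ _) _ => _ /mapP [_ /imageP [e _ ->] ->].
by apply/dual_Pmx => j; rewrite yX mxE normr_sign.
Qed.

Lemma reflexive_Pmx_inv n (P : 'cV[R]_n -> Prop) (V : 'M[int]_n) :
  \det V != 0 -> same P (Pmx R V) -> is_reflexive P -> reflexive_mx V.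
Proof.
move=> dV PV [_ [s dualP]]; have uV := toR_unit R dV.
have sign_row_lift (e : 'I_n -> bool) : exists u : 'rV[int]_n, u *m V = sign_row e.
  pose y : 'cV[R]_n := (toR R (sign_row e) *m invmx (toR R V))^T.
  have yV : y^T *m toR R V = toR R (sign_row e) by rewrite trmxK mulmxKV.
  have /(vertex_same y) vy : same (dual (Pmx R V)) (conv_pts (map (@toR R n 1) s)).
    move=> z; rewrite -dualP; split=> dz x /PV; exact: dz.
  have /vy /vertex_conv_set /mapP [x _ yE] : vertex (dual (Pmx R V)) y.
    by apply: vertex_dual_Pmx => // j; rewrite yV !mxE rmorph_sign normr_sign.
  exists x^T; apply: (@toR_inj R); rewrite toRM -yV yE.
  by rewrite /toR map_trmx.
have [u uV1] := sign_row_lift (fun=> false).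
have /fin_all_exists [q qV] k := sign_row_lift (fun j => j == k).
split; last by exists u; rewrite uV1; apply/rowP=> j; rewrite !mxE.
exists (\matrix_k (u - q k)); apply/row_matrixP => k; rewrite row_mul rowK mulmxBl uV1 qV.
by apply/rowP=> j; rewrite !mxE eq_sym; case: eqP.
Qed.

Lemma reflexive_cs_cross n (P : 'cV[R]_n -> Prop) : is_reflexive P -> cs_cross P ->
  exists2 V, reflexive_mx V & same P (Pmx R V).
Proof. by move=> rP [V [dV PV]]; exists V => //; apply: reflexive_Pmx_inv rP. Qed.

Lemma cs_cross_Pmx n (X : 'M[int]_n) : reflexive_mx X -> cs_cross (Pmx R X).
Proof. by move=> /reflexive_det dX; exists X. Qed.
End Duality.

(** * Facets *)

Section Facets.
Variable R : realType.
Implicit Types n : nat.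

Lemma vertex_face n (P F : 'cV[R]_n -> Prop) (u : 'cV[R]_n) (c : R) x :
  (forall y, P y -> c <= pair u y) -> (forall x, F x <-> P x /\ pair u x = c) ->
  vertex F x <-> vertex P x /\ pair u x = c.
Proof.
move=> cP FE; split=> [[/FE [Px ux] extx]|[[Px extx] ux]].
  split=> //; split=> // y z t Py Pz t01 xE.
  have uyz : c = t * pair u y + (1 - t) * pair u z by rewrite -pairDr -xE.
  case/andP: (t01) => t0 t1; move: (cP y Py) (cP z Pz) => cy cz.
  by apply: (extx y z t) => //; apply/FE; split=> //; nra.
split=> [|y z t /FE [Py _] /FE [Pz _]]; first exact/FE.
exact: extx.
Qed.

Lemma l1_ball_tight n (a : 'I_n -> R) (t : 'cV[R]_n) (r : R) j :
  (forall k, `|a k| <= r) -> l1_ball t -> r <= `|\sum_k a k * t k 0| -> `|a j| < r -> t j 0 = 0.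
Proof.
move=> ar t1 r_le arj; have r0 : 0 <= r := le_trans (normr_ge0 _) (ar j).
have slack_ge0 k : 0 <= (r - `|a k|) * `|t k 0| by rewrite mulr_ge0 // subr_ge0.
have slack_le0 : \sum_k (r - `|a k|) * `|t k 0| <= 0.
  under eq_bigr do rewrite mulrBl -normrM.
  rewrite sumrB -mulr_sumr subr_le0; apply: le_trans (ler_norm_sum _ _ _).
  by apply: le_trans r_le; rewrite ler_piMr.
have /psumr_eq0P slack0 : \sum_k (r - `|a k|) * `|t k 0| = 0.
  by apply/eqP; rewrite eq_le slack_le0 sumr_ge0.
have /eqP := slack0 (fun k _ => slack_ge0 k) j isT.
by rewrite mulf_eq0 subr_eq0 gt_eqF //= normr_eq0 => /eqP.
Qed.

Lemma aff_indep_unitmx n (p : 'I_n -> 'cV[R]_n) (u : 'cV[R]_n) (c : R) : c != 0 ->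
  (forall i, pair u (p i) = c) ->
  (forall a : 'I_n -> R, \sum_i a i = 0 -> \sum_i a i *: p i = 0 -> forall i, a i = 0) ->
  \matrix_(k, i) p i k 0 \in unitmx.
Proof.
move=> c0 up indep; apply: lin_indep_unitmx => a ap0 i; apply: indep => //.
apply: (mulfI c0); rewrite mulr0 mulr_sumr.
transitivity (pair u (\sum_i a i *: p i)); last by rewrite ap0 pairE mulmx0 mxE.
rewrite pairE mulmx_sumr summxE; apply: eq_bigr => k _.
by rewrite -scalemxAr mxE -pairE up mulrC.
Qed.

(* If some [|u V_j|] were smaller than [-c], all points of the face would have vanishing [j]-th
   coordinate with respect to the columns of [V]. *)
Lemma facet_pairing n (P F : 'cV[R]_n -> Prop) (V : 'M[int]_n) :
  \det V != 0 -> same P (Pmx R V) -> facet P F ->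
  exists (u : 'cV[R]_n) (c : R), [/\ c < 0, forall y, P y -> c <= pair u y,
    forall x, F x <-> P x /\ pair u x = c & forall j, `|(u^T *m toR R V) 0 j| = - c].
Proof.
move=> dV PV [[u [c [u0 [cP FE]]]] [p [Fp indep]]]; have uV := toR_unit R dV.
pose a j := (u^T *m toR R V) 0 j.
have ac j : `|a j| <= - c.
  by apply/norm_le_signP => b; rewrite opprK -pair_signed_col; apply/cP/PV/Pmx_signed_col.
have c0 : c < 0.
  rewrite ltNge; apply/negP => c0; case/eqP: u0.
  apply/trmx_inj/(can_inj (mulmxK uV))/rowP => j; rewrite trmx0 mul0mx [RHS]mxE.
  by apply/normr0_eq0/eqP; rewrite eq_le normr_ge0 andbT (le_trans (ac j)) // oppr_le0.
exists u, c; split=> // j; apply/eqP; rewrite eq_le ac leNgt; apply/negP => aj.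
have up i : pair u (p i) = c by have [] := (FE (p i)).1 (Fp i).
have uT : \matrix_(k, i) p i k 0 \in unitmx.
  by apply: aff_indep_unitmx up indep; rewrite lt_eqF.
pose T := invmx (toR R V) *m \matrix_(k, i) p i k 0.
have Tj0 : row j T = 0.
  apply/rowP=> i; rewrite [RHS]mxE.
  have -> : row j T 0 i = (invmx (toR R V) *m p i) j 0.
    by rewrite /T !mxE; apply: eq_bigr => k _; rewrite !mxE.
  apply: (l1_ball_tight ac) aj.
    apply/(Pmx_mulmx _ dV); rewrite mulKVmx //; exact/PV/((FE (p i)).1 (Fp i)).1.
  suff -> : \sum_k a k * (invmx (toR R V) *m p i) k 0 = c by rewrite ltr0_norm.
  by rewrite -(up i) pairE -[p i in RHS](mulKVmx uV) (mulmxA u^T) [RHS]mxE.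
have uTV : T \in unitmx by rewrite unitmx_mul unitmx_inv uV.
move/(congr1 (mulmx^~ (invmx T))): Tj0; rewrite -row_mul mulmxV // row1 mul0mx => /rowP /(_ j).
by move/eqP; rewrite !mxE !eqxx oner_eq0.
Qed.

Lemma facet_wirth n (P F : 'cV[R]_n -> Prop) : (0 < n)%N ->
  is_reflexive P -> cs_cross P -> facet P F ->
  exists B A : 'M[int]_n, [/\ B \in unitmx, wirth A,
    forall x, vertex F x <-> exists j, x = toR R (col j (B *m A)) &
    same P (Pmx R (B *m A))].
Proof.
move=> n0 rP csP fF; have [V rV PV] := reflexive_cs_cross rP csP.
have dV := reflexive_det rV.
have [u [c [c0 cP FE uV]]] := facet_pairing dV PV fF.
pose e j := 0 < (u^T *m toR R V) 0 j.
have on_facet j (b : bool) : pair u (signed_col R V j b) = c <-> b = e j.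
  rewrite pair_signed_col; have := uV j; rewrite /e.
  by case: (ltrgt0P ((u^T *m toR R V) 0 j)) => ? ?; case: b; rewrite ?expr1 ?expr0; split=> //; lra.
have [B [A [s [uB wA BA]]]] := reflexive_wirth_form n0 (reflexive_sign e rV).
have colBA j b : signed_col R (B *m A) (s j) b = signed_col R V j (b (+) e j).
  rewrite -signed_colZ /signed_col; congr (_ *: _); rewrite -toR_sign; congr toR.
  rewrite -BA -[s]invgK -col_permE invgK mul_mx_diag; apply/colP=> i.
  by rewrite !mxE permK mulrC.
exists B, A; split=> // [x|x].
  rewrite (vertex_face _ cP FE) (vertex_same _ PV) (vertex_Pmx _ dV); split.
    case=> [[n00|[j [b ->]]]]; first by rewrite n00 in n0.
    by move/on_facet=> ->; exists (s j); rewrite -signed_colF colBA.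
  move=> [j ->]; rewrite -signed_colF -[j](permKV s) colBA; split; last exact/on_facet.
  by right; do 2!eexists.
rewrite PV; split; apply: Pmx_mono => j b; last by rewrite -[j](permKV s) colBA; do 2!eexists.
by exists (s j), (b (+) e j); rewrite colBA addbK.
Qed.
End Facets.

(** * Free sums *)

Section FreeSums.
Variable R : realType.
Implicit Types n m : nat.

Definition convex_nbhd0 n (P : 'cV[R]_n -> Prop) := convex P /\ zero_interior P.

Lemma Fano_convex_nbhd0 n (P : 'cV[R]_n -> Prop) : Fano P -> convex_nbhd0 P.
Proof. by move=> [/lattice_polytope_convex cP [iP _]]. Qed.

Lemma Fano_same n (P Q : 'cV[R]_n -> Prop) : same P Q -> Fano Q -> Fano P.
Proof.
move=> PQ [[s Qs] [[e [e0 Qe]] primQ]]; split; last split.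
- by exists s => x; rewrite PQ.
- by exists e; split=> // x /Qe /PQ.
- by move=> x /(vertex_same _ PQ); apply: primQ.
Qed.

Lemma vertex_scale_eq1 n (P : 'cV[R]_n -> Prop) y (t : R) : P 0 -> P y -> 0 <= t <= 1 ->
  vertex P (t *: y) -> t *: y != 0 -> t = 1.
Proof.
move=> P0 Py /andP[t0 t1] [_ extty] ty0; apply/eqP; rewrite eq_le t1 leNgt; apply/negP => t_lt1.
have t_gt0 : 0 < t by rewrite lt_neqAle t0 andbT; apply: contraNneq ty0 => <-; rewrite scale0r.
have := extty y 0 t Py P0; rewrite t_gt0 scaler0 addr0 => /(_ t_lt1 erefl) y0.
by rewrite y0 scaler0 eqxx in ty0.
Qed.

Section Vertices.
Variables (n1 n2 : nat) (P : 'cV[R]_n1 -> Prop) (Q : 'cV[R]_n2 -> Prop).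
Hypotheses (nP : convex_nbhd0 P) (nQ : convex_nbhd0 Q).

Let P0 : P 0 := zero_interior0 nP.2.
Let Q0 : Q 0 := zero_interior0 nQ.2.

Lemma freesumP x : freesum P Q x <->
  exists t y z, [/\ 0 <= t <= 1, P y, Q z & x = col_mx (t *: y) ((1 - t) *: z)].
Proof.
pose joins x := exists t y z, [/\ 0 <= t <= 1, P y, Q z & x = col_mx (t *: y) ((1 - t) *: z)].
split=> [|[t [y [z [t01 Py Qz ->]]]]]; last first.
  have -> : col_mx (t *: y) ((1 - t) *: z) = t *: col_mx y 0 + (1 - t) *: col_mx 0 z.
    by rewrite !scale_col_mx add_col_mx !scaler0 addr0 add0r.
  by apply: convex_conv_set => //; apply: mem_conv_set; [left; exists y | right; exists z].
apply: (conv_set_min (C := joins)) => [v w s|{}x].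
  move=> [t1 [y1 [z1 [/andP[t10 t11] Py1 Qz1 ->]]]] [t2 [y2 [z2 [/andP[t20 t21] Py2 Qz2 ->]]]].
  move=> /andP[s0 s1]; pose t := s * t1 + (1 - s) * t2.
  have [||y Py yE] := @convex_cone _ _ P _ _ (s * t1) ((1 - s) * t2) nP.1 Py1 Py2; try nra.
  have [||z Qz zE] := @convex_cone _ _ Q _ _ (s * (1 - t1)) ((1 - s) * (1 - t2)) nQ.1 Qz1 Qz2;
    try nra.
  exists t, y, z; split=> //; first by apply/andP; split; rewrite /t; nra.
  rewrite !scale_col_mx add_col_mx !scalerA yE zE; congr (col_mx _ (_ *: _)).
  by rewrite /t; ring.
case=> [[y [Py ->]]|[z [Qz ->]]].
  by exists 1, y, 0; rewrite scale1r scaler0 ler01 lexx.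
by exists 0, 0, z; rewrite scaler0 subr0 scale1r ler01 lexx.
Qed.

Lemma zero_interior_freesum : zero_interior (freesum P Q).
Proof.
have [[e [e0 Pe]] [e' [e'0 Qe']]] := (nP.2, nQ.2).
exists (Num.min e e' / 2); split=> [|x x_small]; first by rewrite divr_gt0 // lt_min e0.
apply/freesumP; exists 2^-1, (2 *: usubmx x), (2 *: dsubmx x); split; first lra.
- apply: Pe => i; rewrite !mxE normrM ger0_norm // mulrC -ler_pdivlMr //.
  by apply: le_trans (x_small _) _; rewrite ler_pM2r ?ge_min ?lexx // invr_gt0.
- apply: Qe' => i; rewrite !mxE normrM ger0_norm // mulrC -ler_pdivlMr //.
  by apply: le_trans (x_small _) _; rewrite ler_pM2r ?ge_min ?lexx ?orbT // invr_gt0.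
rewrite !scalerA (_ : 1 - 2^-1 = 2^-1) ?mulVf ?pnatr_eq0 ?scale1r ?vsubmxK //.
by lra.
Qed.

Lemma vertex_freesum_left y : y != 0 ->
  vertex (freesum P Q) (col_mx y 0) <-> vertex P y.
Proof.
have shrink t y' : 0 <= t <= 1 -> P y' -> P (t *: y').
  by move=> t01 Py'; have := nP.1 y' 0 t Py' P0 t01; rewrite scaler0 addr0.
move=> y0; split=> [[Py exty]|vy].
  split; last first.
    move=> y1 y2 t Py1 Py2 t01 yE.
    have := exty (col_mx y1 0) (col_mx y2 0) t; case/(_ _ _ _ _)/eq_col_mx => //.
    - by apply: mem_conv_set; left; exists y1.
    - by apply: mem_conv_set; left; exists y2.
    - by rewrite !scale_col_mx add_col_mx !scaler0 addr0 yE.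
  have /freesumP [t [y' [z [t01 Py' Qz /eq_col_mx [-> _]]]]] := Py.
  exact: shrink.
have [Py exty] := vy; split=> [|v w s]; first by apply: mem_conv_set; left; exists y.
move=> /freesumP [t1 [y1 [z1 [t101 Py1 _ ->]]]] /freesumP [t2 [y2 [z2 [t201 Py2 _ ->]]]] s01.
rewrite !scale_col_mx add_col_mx => /eq_col_mx [yE _].
have y12 := exty _ _ s (shrink _ _ t101 Py1) (shrink _ _ t201 Py2) s01 yE.
have y1E : y = t1 *: y1 by rewrite yE -y12 -scalerDl addrC subrK scale1r.
have y2E : y = t2 *: y2 by rewrite y1E.
have t1E : t1 = 1 by apply: (vertex_scale_eq1 P0 Py1); rewrite // -y1E.
have t2E : t2 = 1 by apply: (vertex_scale_eq1 P0 Py2); rewrite // -y2E.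
by rewrite y12 t1E t2E subrr !scale0r.
Qed.
End Vertices.

Lemma vertex_freesumC n1 n2 (P : 'cV[R]_n1 -> Prop) (Q : 'cV[R]_n2 -> Prop) y z :
  convex_nbhd0 P -> convex_nbhd0 Q ->
  vertex (freesum P Q) (col_mx y z) <-> vertex (freesum Q P) (col_mx z y).
Proof.
pose swap m1 m2 : 'M[R]_(m2 + m1, m1 + m2) := block_mx 0 1%:M 1%:M 0.
have swap_col m1 m2 (v : 'cV_m1) (w : 'cV_m2) : swap m1 m2 *m col_mx v w = col_mx w v.
  by rewrite mul_block_col !mul0mx !mul1mx addr0 add0r.
have swapK m1 m2 : swap m2 m1 *m swap m1 m2 = 1%:M.
  by rewrite mulmx_block !mul0mx !mulmx0 !mul1mx !addr0 !add0r -scalar_mx_block.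
have freesum_swap m1 m2 (P' : 'cV_m1 -> Prop) (Q' : 'cV_m2 -> Prop) x :
    convex_nbhd0 P' -> convex_nbhd0 Q' -> freesum P' Q' x -> freesum Q' P' (swap m1 m2 *m x).
  move=> nP' nQ' /freesumP [||t [v [w [t01 Pv Qw ->]]]] //; apply/freesumP => //.
  exists (1 - t), w, v; split=> //; last by rewrite swap_col subKr.
  by case/andP: t01 => *; apply/andP; split; lra.
move=> nP nQ; rewrite -(swap_col _ _ y z); apply: vertex_mulmx (swapK n1 n2) (swapK n2 n1) _ => x.
split; first exact: freesum_swap.
by move/(freesum_swap _ _ _ _ _ nQ nP); rewrite mulmxA swapK mul1mx.
Qed.

Lemma vertex_freesum n1 n2 (P : 'cV[R]_n1 -> Prop) (Q : 'cV[R]_n2 -> Prop) x :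
  (0 < n1 + n2)%N -> convex_nbhd0 P -> convex_nbhd0 Q ->
  vertex (freesum P Q) x <-> (exists y, [/\ vertex P y, y != 0 & x = col_mx y 0]) \/
                             (exists z, [/\ vertex Q z, z != 0 & x = col_mx 0 z]).
Proof.
move=> n0 nP nQ; split=> [vx|[[y [vy y0 ->]]|[z [vz z0 ->]]]].
- have x0 : x != 0.
    apply: contraTneq n0 => x0; rewrite x0 in vx.
    by rewrite (zero_interior_vertex0 (zero_interior_freesum nP nQ) vx).
  case: (vertex_conv_set vx) => [[y [_ xE]]|[z [_ xE]]]; rewrite xE in vx x0 *; [left | right].
    have y0 : y != 0 by apply: contraNneq x0 => ->; rewrite col_mx0.
    by exists y; split=> //; apply/(vertex_freesum_left nP nQ y0).
  have z0 : z != 0 by apply: contraNneq x0 => ->; rewrite col_mx0.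
  by exists z; split=> //; apply/(vertex_freesum_left nQ nP z0)/vertex_freesumC.
- exact/vertex_freesum_left.
- by apply/vertex_freesumC => //; apply/vertex_freesum_left.
Qed.

Lemma iso_freesum n1 n2 m1 m2 (P : 'cV[R]_n1 -> Prop) (Q : 'cV[R]_n2 -> Prop)
    (P' : 'cV[R]_m1 -> Prop) (Q' : 'cV[R]_m2 -> Prop) : (0 < n1 + n2)%N ->
  convex_nbhd0 P -> convex_nbhd0 Q -> convex_nbhd0 P' -> convex_nbhd0 Q' ->
  iso P P' -> iso Q Q' -> iso (freesum P Q) (freesum P' Q').
Proof.
move=> n0 nP nQ nP' nQ' iPP' iQQ'.
have m0 : (0 < m1 + m2)%N by rewrite -(iso_dim iPP') -(iso_dim iQQ').
case: iPP' iQQ' => [U1 [V1 [VU1 [UV1 [PP' P'P]]]]] [U2 [V2 [VU2 [UV2 [QQ' Q'Q]]]]].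
have toR_neq0 k l (U : 'M_(l, k)) (V : 'M_(k, l)) (v : 'cV[R]_k) : V *m U = 1%:M ->
    v != 0 -> toR R U *m v != 0.
  by move=> VU; apply: contraNneq => Uv0; rewrite -(toR_mulK v VU) Uv0 mulmx0.
exists (dsum_mx U1 U2), (dsum_mx V1 V2); rewrite !mul_dsum_mx VU1 VU2 UV1 UV2 !dsum_scalar_mx.
rewrite toR_dsum; do 2!split=> //; split=> [x|x'] /vertex_freesum [] // [v [vv v0 ->]].
- rewrite mul_dsum_col mulmx0; apply/vertex_freesum => //; left; exists (toR R U1 *m v).
  by split=> //; [apply: PP' | apply: toR_neq0 VU1 v0].
- rewrite mul_dsum_col mulmx0; apply/vertex_freesum => //; right; exists (toR R U2 *m v).
  by split=> //; [apply: QQ' | apply: toR_neq0 VU2 v0].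
- have [y [vy vE]] := P'P v vv; exists (col_mx y 0); rewrite mul_dsum_col mulmx0 -vE; split=> //.
  apply/vertex_freesum => //; left; exists y; split=> //.
  by apply: contraNneq v0 => y0; rewrite vE y0 mulmx0.
- have [z [vz vE]] := Q'Q v vv; exists (col_mx 0 z); rewrite mul_dsum_col mulmx0 -vE; split=> //.
  apply/vertex_freesum => //; right; exists z; split=> //.
  by apply: contraNneq v0 => z0; rewrite vE z0 mulmx0.
Qed.

Lemma l1norm_col_mx n1 n2 (s : 'cV[R]_n1) (t : 'cV[R]_n2) :
  l1norm (col_mx s t) = l1norm s + l1norm t.
Proof.
rewrite /l1norm big_split_ord; congr (_ + _); apply: eq_bigr => i _;
  by rewrite ?col_mxEu ?col_mxEd.
Qed.

Lemma signed_col_dsum_l n1 n2 (X : 'M[int]_n1) (Y : 'M_n2) j b :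
  signed_col R (dsum_mx X Y) (lshift n2 j) b = col_mx (signed_col R X j b) 0.
Proof.
rewrite !signed_colE toR_dsum -(mulmx0 _ (toR R Y)) -mul_dsum_col; congr (_ *m _).
by rewrite -[X in col_mx _ X](scaler0 _ ((-1) ^+ b)) -scale_col_mx delta_mx_ushift.
Qed.

Lemma signed_col_dsum_r n1 n2 (X : 'M[int]_n1) (Y : 'M_n2) j b :
  signed_col R (dsum_mx X Y) (rshift n1 j) b = col_mx 0 (signed_col R Y j b).
Proof.
rewrite !signed_colE toR_dsum -(mulmx0 _ (toR R X)) -mul_dsum_col; congr (_ *m _).
by rewrite -[X in col_mx X _](scaler0 _ ((-1) ^+ b)) -scale_col_mx delta_mx_dshift.
Qed.

Lemma freesum_Pmx n1 n2 (X : 'M[int]_n1) (Y : 'M_n2) :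
  same (freesum (Pmx R X) (Pmx R Y)) (Pmx R (dsum_mx X Y)).
Proof.
have Pmx0 n (Z : 'M[int]_n) : Pmx R Z 0 by apply: mem_conv_set; rewrite inE eqxx.
move=> x; split.
  apply: conv_set_min => [|_ [[_ [/PmxP [s s1 ->] ->]]|[_ [/PmxP [s s1 ->] ->]]]].
  - exact: convex_conv_set.
  - apply/PmxP; exists (col_mx s 0); rewrite ?toR_dsum ?mul_dsum_col ?mulmx0 //.
    by rewrite /l1_ball l1norm_col_mx l1norm0 ?addr0 ?add0r.
  - apply/PmxP; exists (col_mx 0 s); rewrite ?toR_dsum ?mul_dsum_col ?mulmx0 //.
    by rewrite /l1_ball l1norm_col_mx l1norm0 ?addr0 ?add0r.
apply: conv_set_mono => y /Pmx_generatorsP [->|[j [b ->]]].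
  by left; exists 0; rewrite col_mx0.
case: (split_ordP j) => k ->; [left | right].
  by exists (signed_col R X k b); split; [apply: Pmx_signed_col | apply: signed_col_dsum_l].
by exists (signed_col R Y k b); split; [apply: Pmx_signed_col | apply: signed_col_dsum_r].
Qed.

(** * Splitting off segments *)

Lemma signed_col_1 (j : 'I_1) (b : bool) : signed_col R 1%:M j b = const_mx ((-1) ^+ b).
Proof. by apply/colP=> i; rewrite !mxE !ord1 eqxx mulr1. Qed.

Lemma seg_Pmx : same (@seg R) (Pmx R (1%:M : 'M_1)).
Proof.
have seg_end (b : bool) : @seg R (const_mx ((-1) ^+ b)).
  by apply: mem_conv_set; case: b; rewrite !inE ?expr0 ?expr1 eqxx ?orbT.
move=> x; split; apply: conv_set_min; try exact: convex_conv_set.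
  move=> y; rewrite !inE => /orP[] /eqP ->.
    by have := Pmx_signed_col R 1%:M (0 : 'I_1) false; rewrite signed_col_1.
  by have := Pmx_signed_col R 1%:M (0 : 'I_1) true; rewrite signed_col_1.
move=> y /Pmx_generatorsP [->|[j [b ->]]]; last by rewrite signed_col_1.
have /(_ 2^-1) := convex_conv_set (seg_end false) (seg_end true).
set mid := _ + _; have -> : mid = 0 by apply/colP=> i; rewrite !mxE expr0 expr1; field.
by apply; lra.
Qed.

Lemma vertex_seg x : vertex (@seg R) x <-> exists b : bool, x = const_mx ((-1) ^+ b).
Proof.
rewrite (vertex_same _ seg_Pmx) vertex_Pmx ?det1 ?oner_eq0 //.
split=> [[//|[j [b ->]]]|[b ->]]; first by exists b; apply: signed_col_1.
by right; exists 0, b; rewrite signed_col_1.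
Qed.

Lemma Fano_seg : Fano (@seg R).
Proof. exact: Fano_same seg_Pmx (Fano_Pmx R (reflexive_mx1 1)). Qed.

Lemma iso_freesum_seg n m (Q : 'cV[R]_n -> Prop) (Z : 'M[int]_m) : Fano Q -> reflexive_mx Z ->
  iso Q (Pmx R Z) -> iso (freesum (@seg R) Q) (Pmx R (unit_ext 1 Z)).
Proof.
move=> fQ rZ iQZ; apply: iso_trans (iso_same (freesum_Pmx _ _)).
apply: iso_freesum (iso_same seg_Pmx) iQZ => //; apply: Fano_convex_nbhd0 => //.
- exact: Fano_seg.
- exact: Fano_Pmx (reflexive_mx1 1).
- exact: Fano_Pmx.
Qed.

Lemma splits_unit_ext1 n (P : 'cV[R]_n -> Prop) m (Z : 'M[int]_m) : reflexive_mx Z ->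
  iso P (Pmx R (unit_ext 1 Z)) -> splits P (@seg R) (Pmx R Z).
Proof.
move=> rZ iPZ; split; [exact: Fano_seg | split; first exact: Fano_Pmx].
by apply: iso_trans iPZ (iso_sym (iso_freesum_seg _ rZ (iso_refl _))); apply: Fano_Pmx.
Qed.

Lemma splits_segs_unit_ext n (P : 'cV[R]_n -> Prop) n' (P' : 'cV[R]_n' -> Prop) r
    m (Y : 'M[int]_m) :
  splits_segs P P' r -> reflexive_mx Y -> iso P' (Pmx R Y) -> iso P (Pmx R (unit_ext r Y)).
Proof.
move=> splitP rY.
elim: splitP => {n P n' P' r} [n P n' P' iPP'|n P n2 Q n' P' r [_ [fQ iPQ]] _ IH] iP'Y.
  by rewrite unit_ext0; apply: iso_trans iPP' iP'Y.
rewrite unit_extS; apply: iso_trans iPQ _; apply: iso_freesum_seg fQ _ (IH iP'Y).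
exact/reflexive_unit_ext.
Qed.

Lemma unit_ext_splits_segs n (P : 'cV[R]_n -> Prop) r m (Y : 'M[int]_m) :
  reflexive_mx Y -> iso P (Pmx R (unit_ext r Y)) -> splits_segs P (Pmx R Y) r.
Proof.
move=> rY; elim: r n P => [|r IH] n P; first by rewrite unit_ext0; apply: splits_segs0.
rewrite unit_extS => iP; apply: (@splits_segsS _ _ _ _ (Pmx R (unit_ext r Y))).
  by apply: splits_unit_ext1; first exact/reflexive_unit_ext.
exact: IH (iso_refl _).
Qed.

Lemma one_irreducible_iso n m (P : 'cV[R]_n -> Prop) (Q : 'cV[R]_m -> Prop) :
  iso P Q -> one_irreducible P -> one_irreducible Q.
Proof.
move=> iPQ irrP [n2 [S [fseg [fS iQS]]]]; apply: irrP; exists n2, S.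
by do 2!split=> //; apply: iso_trans iPQ iQS.
Qed.

Lemma one_irreducible_unit_ext r n (X : 'M[int]_n) : reflexive_mx X ->
  one_irreducible (Pmx R (unit_ext r X)) -> r = 0%N.
Proof.
case: r => // r rX; rewrite unit_extS => -[].
exists (r + n)%N, (Pmx R (unit_ext r X)).
by apply: splits_unit_ext1 (iso_refl _); apply/reflexive_unit_ext.
Qed.

Lemma iso_unit_ext1_cancel n m (X : 'M[int]_n) (Y : 'M[int]_m) :
  reflexive_mx X -> reflexive_mx Y ->
  iso (Pmx R (unit_ext 1 X)) (Pmx R (unit_ext 1 Y)) -> iso (Pmx R X) (Pmx R Y).
Proof.
move=> rX rY iXY; have /eqP := iso_dim iXY; rewrite eqn_add2l => /eqP nm; subst m.
apply/mx_equiv_iso/(mx_equiv_unit_ext1_cancel rX rY).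
by apply: iso_mx_equiv iXY; apply/reflexive_unit_ext.
Qed.

Lemma unit_ext_unique r1 r2 n1 n2 (Y1 : 'M[int]_n1) (Y2 : 'M[int]_n2) :
  reflexive_mx Y1 -> reflexive_mx Y2 ->
  one_irreducible (Pmx R Y1) -> one_irreducible (Pmx R Y2) ->
  iso (Pmx R (unit_ext r1 Y1)) (Pmx R (unit_ext r2 Y2)) ->
  r1 = r2 /\ iso (Pmx R Y1) (Pmx R Y2).
Proof.
move=> rY1 rY2 irr1 irr2; elim: r1 r2 => [|r1 IH] [|r2].
- by rewrite !unit_ext0.
- by rewrite unit_ext0 => /one_irreducible_iso /(_ irr1) /(one_irreducible_unit_ext rY2).
- by rewrite unit_ext0 => /iso_sym /one_irreducible_iso /(_ irr2) /(one_irreducible_unit_ext rY1).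
rewrite (unit_extS r1) (unit_extS r2) => /iso_unit_ext1_cancel iY.
by have [|-> //] := IH r2; apply: iY; apply/reflexive_unit_ext.
Qed.

(* A splitting off of [-1,1] yields an integral functional [l] with [l X] equal to plus or minus
   a unit row. *)
Lemma one_irreducible_no_unit_row n (X : 'M[int]_n) : reflexive_mx X ->
  (forall j, ~~ ((delta_mx 0 j : 'rV_n) <= modF2 X)%MS) -> one_irreducible (Pmx R X).
Proof.
move=> rX no_unit [n2 [Q [/Fano_convex_nbhd0 nseg [/Fano_convex_nbhd0 nQ iXQ]]]].
have n_gt0 : n != 0%N by rewrite (iso_dim iXQ).
have [U [V [VU [UV [XQ QX]]]]] := iXQ; have dX := reflexive_det rX.
have end0 : const_mx 1 != 0 :> 'cV[R]_1.
  by apply/eqP=> /colP /(_ 0) /eqP; rewrite !mxE oner_eq0.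
have /QX [x [/(vertex_Pmx _ dX)]] : vertex (freesum (@seg R) Q) (col_mx (const_mx 1) 0).
  by apply/vertex_freesum_left => //; apply/vertex_seg; exists false.
case=> [n0|[j [b ->]] Uj]; first by rewrite n0 in n_gt0.
pose l : 'rV[int]_n := usubmx U.
have lX k (c : bool) : (-1) ^+ c * ((l *m X) 0 k)%:~R = usubmx (toR R U *m signed_col R X k c) 0 0.
  rewrite -scalemxAr -toRM !mxE; congr (_ * _%:~R).
  by apply: eq_bigr => i _; rewrite !mxE.
have lXj : (l *m X) 0 j = (-1) ^+ b.
  apply: (@intr_inj R); rewrite rmorph_sign -[LHS](signrMK b) lX.
  by rewrite -Uj col_mxKu mxE mulr1.
have lXk k : k != j -> (l *m X) 0 k = 0.
  move=> kj; apply/eqP; rewrite -(@intr_eq0 R); apply/eqP.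
  have := lX k false; rewrite mul1r => ->.
  have /XQ /vertex_freesum [] // : vertex (Pmx R X) (signed_col R X k false).
  - by apply/vertex_Pmx => //; right; exists k, false.
  - move=> [_ [/vertex_seg [c ->] _ Uk]]; case/eqP: kj.
    apply: (@signed_col_inj R _ X k j false (c (+) b) dX); rewrite -signed_colZ.
    rewrite -[LHS](toR_mulK _ VU) -[signed_col _ _ j _](toR_mulK _ VU) Uk -Uj scalemxAr.
    by rewrite scale_col_mx scaler0 scalemx_const mulr1.
  - by move=> [z [_ _ ->]]; rewrite col_mxKu mxE.
case/negP: (no_unit j).
have -> : delta_mx 0 j = modF2 (l *m X).
  apply/rowP=> k; rewrite [LHS]mxE [RHS]mxE eqxx /=.
  by have [->|/lXk ->] := eqVneq k j; [rewrite lXj intr_F2_sign | ].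
by rewrite modF2M submxMl.
Qed.
End FreeSums.

(** * The correspondence *)

Section Correspondence.
Variable R : realType.
Implicit Types n : nat.

Lemma iso_unit_mulP n (X X' B B' : 'M[int]_n) : reflexive_mx X -> reflexive_mx X' ->
  B \in unitmx -> B' \in unitmx ->
  mx_equiv X X' <-> iso (Pmx R (B *m X)) (Pmx R (B' *m X')).
Proof.
move=> rX rX' uB uB'; have [iX iX'] := (iso_unit_mul R X uB, iso_unit_mul R X' uB').
split=> [/(mx_equiv_iso R) iXX'|iBB'].
  exact: iso_trans (iso_sym iX) (iso_trans iXX' iX').
apply: (iso_mx_equiv rX rX'); exact: iso_trans iX (iso_trans iBB' (iso_sym iX')).
Qed.

Lemma reflexive_cs_cross_iso_wirth n (P : 'cV[R]_n -> Prop) : (0 < n)%N ->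
  is_reflexive P -> cs_cross P -> exists A : 'M[int]_n, wirth A /\ iso P (Pmx R A).
Proof.
move=> n0 rP csP; have [V rV PV] := reflexive_cs_cross rP csP.
have [B [A [s [uB wA VsBA]]]] := reflexive_wirth_form n0 rV; exists A; split=> //.
apply: iso_trans (iso_same PV) _; apply: iso_trans (iso_sym (iso_unit_mul R A uB)).
by rewrite -VsBA; apply: mx_equiv_iso; exists 1%:M, s; rewrite unitmx1 mul1mx.
Qed.

Lemma wirth_iso_reduction n (A : 'M[int]_n) : wirth A ->
  iso (Pmx R A) (Pmx R (unit_ext (num_single A) (reduction A))).
Proof. by move/wirth_reorder => [phi bij_phi <-]; apply: iso_mxsub. Qed.

Lemma wirth_1min_irreducible n (A : 'M[int]_n) :
  wirth A -> wirth_1min A <-> one_irreducible (Pmx R A).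
Proof.
move=> wA; split=> [/(wirth_1minP wA) no_unit|irrA].
  exact: one_irreducible_no_unit_row (wirth_reflexive wA) no_unit.
apply: (wirth_1min_num_single wA); apply: (one_irreducible_unit_ext (reflexive_reduction wA)).
exact: one_irreducible_iso (wirth_iso_reduction wA) irrA.
Qed.

Lemma reduction_irreducible n (A : 'M[int]_n) :
  wirth A -> one_irreducible (Pmx R (reduction A)).
Proof.
move=> wA; apply: (one_irreducible_no_unit_row (reflexive_reduction wA)) => j.
have minA := reduction_1min wA (leq_ltn_trans (leq0n j) (ltn_ord j)).
by apply: (wirth_1minP _).1 => //; case: minA => f [wf _]; exists f.
Qed.

Lemma splits_segs_reduction n (P : 'cV[R]_n -> Prop) (A : 'M[int]_n) : wirth A ->
  iso P (Pmx R A) -> splits_segs P (Pmx R (reduction A)) (num_single A).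
Proof.
move=> wA iPA; apply: unit_ext_splits_segs (reflexive_reduction wA) _.
exact: iso_trans iPA (wirth_iso_reduction wA).
Qed.

Lemma splits_segs_wirth n (P : 'cV[R]_n -> Prop) (A : 'M[int]_n) n' (P' : 'cV[R]_n' -> Prop) r :
  wirth A -> iso P (Pmx R A) -> is_reflexive P' -> cs_cross P' -> one_irreducible P' ->
  splits_segs P P' r -> r = num_single A /\ iso P' (Pmx R (reduction A)).
Proof.
move=> wA iPA rP' csP' irrP' splitP.
have [Y rY /iso_same iP'Y] := reflexive_cs_cross rP' csP'.
have iPY := splits_segs_unit_ext splitP rY iP'Y.
have [||||-> iYA] := @unit_ext_unique R r (num_single A) _ _ Y (reduction A) rY.
- exact: reflexive_reduction.
- exact: one_irreducible_iso iP'Y irrP'.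
- exact: reduction_irreducible.
- exact: iso_trans (iso_sym iPY) (iso_trans iPA (wirth_iso_reduction wA)).
by split=> //; apply: iso_trans iP'Y iYA.
Qed.
End Correspondence.

Theorem theorem2p2 (R : realType) (d : nat) (hd : (0 < d)%N) :
  (* (1a) A |-> P_A sends Wirth matrices to is_reflexive cs-crosspolytopes
     (for any lattice basis B) *)
  (forall (A B : 'M[int]_d), wirth A -> B \in unitmx ->
     is_reflexive (Pmx R (B *m A)) /\ cs_cross (Pmx R (B *m A))) /\
  (* (1b) well defined and injective on equivalence classes *)
  (forall (A A' B B' : 'M[int]_d), wirth A -> wirth A' ->
     B \in unitmx -> B' \in unitmx ->
     (mx_equiv A A' <-> iso (Pmx R (B *m A)) (Pmx R (B' *m A')))) /\
  (* (1c) surjective onto isomorphism classes *)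
  (forall P : 'cV[R]_d -> Prop, is_reflexive P -> cs_cross P ->
     exists A : 'M[int]_d, wirth A /\ iso P (Pmx R A)) /\
  (* (1d) inverse map via any facet *)
  (forall (P F : 'cV[R]_d -> Prop), is_reflexive P -> cs_cross P -> facet P F ->
     exists (B A : 'M[int]_d), B \in unitmx /\ wirth A /\
       (forall x, vertex F x <-> exists j, x = toR R (col j (B *m A))) /\
       same P (Pmx R (B *m A))) /\
  (* (2a) 1-minimal Wirth matrices <-> 1-irreducible *)
  (forall (A B : 'M[int]_d), wirth A -> B \in unitmx ->
     (wirth_1min A <-> one_irreducible (Pmx R (B *m A)))) /\
  (* (2b) existence and uniqueness of the splitting *)
  (forall P : 'cV[R]_d -> Prop, is_reflexive P -> cs_cross P ->
     (exists d' (P' : 'cV[R]_d' -> Prop) (r : nat),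
        is_reflexive P' /\ cs_cross P' /\ one_irreducible P' /\
        splits_segs P P' r) /\
     (forall d1 (P1 : 'cV[R]_d1 -> Prop) r1 d2 (P2 : 'cV[R]_d2 -> Prop) r2,
        is_reflexive P1 -> cs_cross P1 -> one_irreducible P1 ->
        splits_segs P P1 r1 ->
        is_reflexive P2 -> cs_cross P2 -> one_irreducible P2 ->
        splits_segs P P2 r2 ->
        r1 = r2 /\ iso P1 P2) /\
     (* (2c) description via the reduction of a Wirth matrix of P *)
     (forall (A : 'M[int]_d) d' (P' : 'cV[R]_d' -> Prop) (r : nat),
        wirth A -> iso P (Pmx R A) ->
        is_reflexive P' -> cs_cross P' -> one_irreducible P' ->
        splits_segs P P' r ->
        r = num_single A /\ iso P' (Pmx R (reduction A)) /\
        ((0 < #|kept A|)%N -> wirth_1min (reduction A)))).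
Proof.
split=> [A B wA uB|].
  have rBA := reflexive_mull uB (wirth_reflexive wA).
  by split; [apply: reflexive_Pmx | apply: cs_cross_Pmx].
split=> [A A' B B' wA wA'|]; first by apply: iso_unit_mulP; apply: wirth_reflexive.
have iso_wirth (P : 'cV[R]_d -> Prop) := @reflexive_cs_cross_iso_wirth R d P hd.
split=> //; split=> [P F rP csP fF|].
  by have [B [A [uB wA vF PA]]] := facet_wirth hd rP csP fF; exists B, A.
split=> [A B wA uB|P rP csP].
  rewrite (wirth_1min_irreducible R wA); have iBA := iso_unit_mul R A uB.
  by split; apply: one_irreducible_iso; last apply: iso_sym.
have [A [wA iPA]] := iso_wirth P rP csP; have rA := reflexive_reduction wA.
split; [|split=> [d1 P1 r1 d2 P2 r2 rP1 csP1 irr1 s1 rP2 csP2 irr2 s2|A' d' P' r wA' iPA']].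
- exists #|kept A|, (Pmx R (reduction A)), (num_single A).
  do 2!(split; first by [apply: reflexive_Pmx | apply: cs_cross_Pmx]).
  by split; [apply: reduction_irreducible | apply: splits_segs_reduction].
- have [-> i1] := splits_segs_wirth wA iPA rP1 csP1 irr1 s1.
  have [-> i2] := splits_segs_wirth wA iPA rP2 csP2 irr2 s2.
  by split=> //; apply: iso_trans i1 (iso_sym i2).
move=> rP' csP' irr' s'; have [-> iP'] := splits_segs_wirth wA' iPA' rP' csP' irr' s'.
by do 2!split=> //; apply: reduction_1min.
Qed.
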